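(* Let $H$ be a complex separable infinite-dimensional Hilbert space, let $T$ be a Read's type operator on $H$ (as defined in the context), and let $V$ be a unitary operator on $H$ such that for every non-zero $x\in H$, either $x$ or $Vx$ has a dense orbit under the action of $T$. Then the two operators $T$ and $V^{-1}TV$ are unitarily equivalent, and the weakly closed (equivalently, strongly closed) algebra $\mathcal{A}$ they generate is equal to $\mathcal{B}(H)$. Moreover, the uniformly closed algebra $\mathcal{R}$ they generate contains all compact operators on $H$.
   Context: $\mathcal{B}(H)$ is the algebra of bounded linear operators on $H$. The weakly (strongly, uniformly) closed algebra generated by $T$ and $V^{-1}TV$ is the closure, in the weak operator topology (strong operator topology, operator norm topology, respectively), of the subalgebra of $\mathcal{B}(H)$ generated by these two operators. For $x\in H$, $\mathrm{Orb}(x,T)=\{T^{n}x : n\ge 0\}$ is the orbit of $x$ under $T$ and $\overline{\mathrm{Orb}}(x,T)$ is its norm closure. A Read's type operator on $H$ means here a bounded linear operator $T$ on $H$ with the following properties. (P1) For every $x\in H$, $\overline{\mathrm{Orb}}(x,T)$ is a linear subspace, i.e. the closures of $\{T^{n}x : n\ge 0\}$ and of $\mathrm{span}\{T^{n}x : n\ge 0\}$ coincide. (P2) For every $x,y\in H$, either $\overline{\mathrm{Orb}}(x,T)\subseteq\overline{\mathrm{Orb}}(y,T)$ or $\overline{\mathrm{Orb}}(y,T)\subseteq\overline{\mathrm{Orb}}(x,T)$. (P') For every closed subspace $M$ of $H$ invariant under $T$, there exists $x\in M$ such that $\overline{\mathrm{Orb}}(x,T)=M$. (Shift structure) There is an orthonormal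 basis $(g_{j})_{j\ge 0}$ of $H$ such that $T=S+K$, where $S$ is a forward weighted shift, $Sg_{j}=w_{j}g_{j+1}$ with $0\le w_{j}\le 2$ for all $j$, the weights being either $0$ or tending to $1$ (for every $\varepsilon>0$, all but finitely many $j$ satisfy $w_{j}=0$ or $|w_{j}-1|<\varepsilon$), and $K$ is a nuclear operator with $\sum_{j\ge 0}\|Kg_{j}\|<\infty$. *)

(* Defs.v *)
From HB Require Import structures.
From mathcomp Require Import all_boot all_order all_algebra.
From mathcomp Require Import sesquilinear complex.
From mathcomp Require Import all_classical all_reals all_analysis.

Set Implicit Arguments.
Unset Strict Implicit.
Unset Printing Implicit Defensive.

Import Order.TTheory GRing.Theory Num.Theory.
Import numFieldNormedType.Exports.

Local Open Scope classical_set_scope.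
Local Open Scope ring_scope.
Local Open Scope complex_scope.

Section LinearAlgebra.
Variables (K : nzRingType) (E : lmodType K).

Definition is_subspace (M : set E) : Prop :=
  M 0 /\ forall (a : K) (x y : E), M x -> M y -> M (a *: x + y).

Definition linear_span (A : set E) : set E := smallest is_subspace A.

Definition infinite_dimensional : Prop :=
  forall A : set E, finite_set A -> linear_span A <> setT.

End LinearAlgebra.

Arguments infinite_dimensional {K} E.

Definition separable_space (X : topologicalType) : Prop :=
  exists2 A : set X, countable A & dense A.

(* Operators are plain functions E -> E, so that equality of operators is
   pointwise equality; linear combinations use the pointwise module structure
   of E -> E. *)
Section Operators.
Variables (R : realType) (E : normedModType R[i]).
Implicit Types (A B T : E -> E) (x : E) (X : set (E -> E)).

Definition bounded_operators : set (E -> E) :=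
  [set A | linear A /\ exists c : R, forall x, `|A x| <= c%:C * `|x|].

Definition Orb T x : set E := [set iter n T x | n in [set: nat]].

(* Norms of vectors take their values in R[i], suprema are taken in R. *)
Definition opnorm A : R :=
  sup [set complex.Re `|A x| | x in [set x : E | `|x| <= 1]].

Definition compact_operators : set (E -> E) :=
  [set A | bounded_operators A /\
           compact (closure [set A x | x in [set x : E | `|x| <= 1]])].

(* The identity is not required to belong to a subalgebra. *)
Definition is_subalgebra X : Prop :=
  [/\ X `<=` bounded_operators, is_subspace X &
      forall A B, X A -> X B -> X (A \o B)].

Definition generated_algebra X : set (E -> E) := smallest is_subalgebra X.

Definition uniform_closure X : set (E -> E) :=
  [set A | bounded_operators A /\
           forall e : R, 0 < e -> exists2 B, X B & opnorm (A - B) < e].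

Definition strong_closure X : set (E -> E) :=
  bounded_operators `&` closure (X : set {ptws E -> E}).

End Operators.

Arguments bounded_operators {R} E.
Arguments compact_operators {R} E.

Section Hilbert.
Variables (R : realType) (H : completeNormedModType R[i]).
Variable dot : {dot H for Num.conj}.
Implicit Types (A B T V : H -> H) (x : H) (X : set (H -> H)).

Definition inner_product_norm : Prop := forall x, `|x| ^+ 2 = dot x x.

Definition matrix_coefficients A : {ptws H * H -> R[i]^o} :=
  fun p => dot (A p.1) p.2.

(* The weak operator topology is the coarsest one for which all the maps
   A |-> dot (A x) y are continuous. *)
Definition weak_closure X : set (H -> H) :=
  bounded_operators H `&`
  closure (X : set (initial_topology matrix_coefficients)).

Definition unitary V : Prop :=
  [/\ linear V, isometry dot dot V & set_surj setT setT V].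

Definition unitarily_equivalent A B : Prop :=
  exists2 U, unitary U & U \o A = B \o U.

Definition orthonormal_basis (g : nat -> H) : Prop :=
  (forall j k, dot (g j) (g k) = (j == k)%:R) /\
  closure (linear_span (range g)) = setT.

Definition forward_weighted_shift (g : nat -> H) (w : nat -> R) (S : H -> H) :=
  bounded_operators H S /\ forall j, S (g j) = (w j)%:C *: g j.+1.

Definition nuclear A : Prop :=
  exists a b : nat -> H,
    cvgn (series (fun n => `|a n| * `|b n|)) /\
    forall x, series (fun n => dot x (a n) *: b n) @ \oo --> A x.

Record read_type_operator T : Prop := {
  read_bounded : bounded_operators H T;
  read_orbit_subspace : forall x, is_subspace (closure (Orb T x));
  read_orbit_total : forall x y,
    closure (Orb T x) `<=` closure (Orb T y) \/
    closure (Orb T y) `<=` closure (Orb T x);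
  read_invariant_subspace : forall M : set H,
    is_subspace M -> closed M -> T @` M `<=` M ->
    exists2 x, M x & closure (Orb T x) = M;
  read_shift_structure : exists (g : nat -> H) (w : nat -> R) (S K : H -> H),
    [/\ orthonormal_basis g,
        forward_weighted_shift g w S,
        (forall j, 0 <= w j <= 2) /\
        (forall e : R, 0 < e ->
           \forall j \near \oo, w j = 0 \/ `|w j - 1| < e),
        nuclear K /\ cvgn (series (fun j => `|K (g j)|)) &
        T = S + K] }.

End Hilbert.

(* Main.v *)
Require Import Defs.
From mathcomp Require Import all_boot all_order all_algebra.
From mathcomp Require Import sesquilinear complex.
From mathcomp Require Import all_classical all_reals all_analysis.
From mathcomp Require Import ring lra zify.

Import Order.TTheory GRing.Theory Num.Theory.
Import numFieldNormedType.Exports.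

Local Open Scope classical_set_scope.
Local Open Scope ring_scope.

(* Since the weights of the shift are 0 or tend to 1, every power of T, and of
   T' = V^-1 T V, is within distance 2 of the finite rank operators, whereas each
   nonzero vector has a dense orbit under T or T'.  By weak compactness of a ball
   B away from 0, finitely many operators T^n/8 and T'^n/8, each within 1/4 of the
   finite rank operators, suffice to send every point of B back into B; hence
   there are words of every length in these letters that have norm at least 1/2.
   A long word is u X v with u and v close to finite rank operators, so
   suitably normalized long words have norm limit points.  Rescale the letters by
   the critical scalar for boundedness of the words.  If the words were still
   unbounded, a normalized limit W would satisfy W w W = 0 for all words w, which
   contradicts transitivity.  So they are bounded, and iterated limits along an
   ultrafilter of the factors of an infinite word give a nonzero idempotent
   limit; it is a norm limit of finite rank operators, hence of finite rank.  An
   element of minimal rank of the norm closed algebra has rank one (Burnside), and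
   transitivity then yields all finite rank operators. *)

(** No compact operator of the algebra is given, so one has to be created. This is possible because
    two properties scale differently: the distance from the powers of [T] to the finite rank
    operators is bounded uniformly in the exponent, while density of an orbit survives
    multiplication by a nonzero scalar. Dividing all powers by one constant makes them almost of
    finite rank without losing transitivity. The covering argument may call for a different power at
    each step, which is why words in several letters replace the powers of one operator; the
    critical scalar is the inverse of their joint spectral radius. A nonzero norm limit of long
    words is merely compact. An idempotent is sought because an idempotent close enough to a finite
    rank operator has finite rank itself; it plays the part of a Riesz projection, without
    functional calculus. Finite rank is what makes the minimality argument available. *)

Section RealNorm.
Set Implicit Arguments.
Unset Strict Implicit.
Local Open Scope complex_scope.
Variable R : realType.

(* Norms take values in R[i]; [nrm] is the underlying real number. *)
Definition nrm (E : normedZmodType R[i]) (x : E) : R := complex.Re `|x|.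

Section Zmod.
Variable E : normedZmodType R[i].
Implicit Types x y z : E.

Lemma normE x : `|x| = (nrm x)%:C.
Proof.
rewrite /nrm; have : 0 <= `|x| by exact: normr_ge0.
by case: `|x| => a b; rewrite lecE /= => /andP[/eqP ->].
Qed.

Lemma nrm_ge0 x : 0 <= nrm x.
Proof. by have := normr_ge0 x; rewrite normE ler0c. Qed.

Lemma nrm0 : nrm (0 : E) = 0.
Proof. by rewrite /nrm normr0. Qed.

Lemma nrm_eq0 x : nrm x = 0 -> x = 0.
Proof. by move=> h; apply/eqP; rewrite -normr_eq0 normE h. Qed.

Lemma nrm_gt0 x : x != 0 -> 0 < nrm x.
Proof.
move=> x0; rewrite lt_neqAle nrm_ge0 andbT eq_sym.
by apply: contra_neq x0; exact: nrm_eq0.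
Qed.

Lemma nrmN x : nrm (- x) = nrm x.
Proof. by rewrite /nrm normrN. Qed.

Lemma nrmD x y : nrm (x + y) <= nrm x + nrm y.
Proof. by have := ler_normD x y; rewrite !normE -rmorphD/= lecR. Qed.

Lemma nrmC x y : nrm (x - y) = nrm (y - x).
Proof. by rewrite -nrmN opprB. Qed.

Lemma nrmB x y : nrm (x - y) <= nrm x + nrm y.
Proof. by rewrite -(nrmN y) nrmD. Qed.

Lemma nrm_dist z x y : nrm (x - y) <= nrm (x - z) + nrm (z - y).
Proof. by have := nrmD (x - z) (z - y); rewrite addrA subrK. Qed.

Lemma nrmBB x y : nrm x - nrm y <= nrm (x - y).
Proof. by have := nrmD (x - y) y; rewrite subrK lerBlDr. Qed.

Lemma nrm_sum (I : Type) (r : seq I) (P : pred I) (F : I -> E) :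
  nrm (\sum_(i <- r | P i) F i) <= \sum_(i <- r | P i) nrm (F i).
Proof.
elim/big_rec2: _ => [|i y1 y2 _ h]; first by rewrite nrm0.
by apply: (le_trans (nrmD _ _)); rewrite lerD2l.
Qed.

(** Identities between limits are proved below by bounding the difference by an arbitrarily small
    multiple of a constant. The sign of [c] is free, hence the division by [|c| + 1]. *)
Lemma nrm_small_eq0 x (c : R) :
  (forall e : R, 0 < e -> nrm x <= e * c) -> x = 0.
Proof.
move=> h; apply: nrm_eq0; apply: le_anti; rewrite nrm_ge0 andbT.
apply/ler_addgt0Pr => e e0; rewrite add0r.
have c1 : 0 < `|c| + 1 by rewrite ltr_wpDl.
apply: (le_trans (h (e / (`|c| + 1)) _)); first exact: divr_gt0.
rewrite mulrAC ler_pdivrMr// ler_pM2l//.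
by rewrite (le_trans (ler_norm _))// lerDl.
Qed.

Lemma nrm_small_le x (k c : R) :
  (forall e : R, 0 < e -> nrm x <= e * c + k) -> nrm x <= k.
Proof.
move=> h; apply/ler_addgt0Pr => e e0.
have c1 : 0 < `|c| + 1 by rewrite ltr_wpDl.
apply: (le_trans (h (e / (`|c| + 1)) _)); first exact: divr_gt0.
rewrite addrC lerD2l mulrAC ler_pdivrMr// ler_pM2l//.
by rewrite (le_trans (ler_norm _))// lerDl.
Qed.

End Zmod.

Lemma nrmM (a b : R[i]) : nrm (a * b) = nrm a * nrm b.
Proof. by apply/complexI; rewrite rmorphM/= -!normE normrM. Qed.

Lemma nrm_real (a : R) : nrm (a%:C) = `|a|.
Proof. by apply/complexI; rewrite -normE normc_def/= expr0n addr0 sqrtr_sqr. Qed.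

Lemma nrmZ (E : normedModType R[i]) (a : R[i]) (x : E) :
  nrm (a *: x) = nrm a * nrm x.
Proof. by apply/complexI; rewrite rmorphM/= -!normE normrZ. Qed.

Lemma nrmZR (E : normedModType R[i]) (a : R) (x : E) :
  0 <= a -> nrm (a%:C *: x) = a * nrm x.
Proof. by move=> a0; rewrite nrmZ nrm_real ger0_norm. Qed.

Lemma nrm_Re (a : R[i]) : `|complex.Re a| <= nrm a.
Proof.
by rewrite -lecR -normE; exact: normc_ge_Re.
Qed.

Lemma nrm_Im (a : R[i]) : `|complex.Im a| <= nrm a.
Proof.
have := nrm_Re (a * 'i%C); rewrite ReiNIm normrN nrmM.
suff -> : nrm ('i%C : R[i]) = 1 by rewrite mulr1.
by apply/complexI; rewrite -normE normc_def/= expr0n expr1n add0r sqrtr1.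
Qed.

Lemma nrm_ReIm (a : R[i]) : nrm a <= `|complex.Re a| + `|complex.Im a|.
Proof.
rewrite {1}[a]complexE; apply: (le_trans (nrmD _ _)).
rewrite nrmM !nrm_real.
suff -> : nrm ('i%C : R[i]) = 1 by rewrite mul1r.
by apply/complexI; rewrite -normE normc_def/= expr0n expr1n add0r sqrtr1.
Qed.

End RealNorm.

(** * Linear functions without a bundled structure *)

Section LinearMaps.
Set Implicit Arguments.
Unset Strict Implicit.
Variables (K : nzRingType) (E F : lmodType K) (A : E -> F).
Hypothesis linA : linear A.

Lemma linmapD x y : A (x + y) = A x + A y.
Proof. by have := linA 1 x y; rewrite !scale1r. Qed.

Lemma linmap0 : A 0 = 0.
Proof. by apply: (addIr (A 0)); rewrite -linmapD !add0r. Qed.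

Lemma linmapZ a x : A (a *: x) = a *: A x.
Proof. by have := linA a x 0; rewrite linmap0 !addr0. Qed.

Lemma linmapN x : A (- x) = - A x.
Proof. by rewrite -scaleN1r linmapZ scaleN1r. Qed.

Lemma linmapB x y : A (x - y) = A x - A y.
Proof. by rewrite linmapD linmapN. Qed.

Lemma linmap_sum (I : Type) (r : seq I) (P : pred I) (h : I -> E) :
  A (\sum_(i <- r | P i) h i) = \sum_(i <- r | P i) A (h i).
Proof. by elim/big_rec2: _ => [|i y1 y2 _ <-]; rewrite ?linmap0 ?linmapD. Qed.

End LinearMaps.

(** * The norm topology in terms of the real-valued norm *)

Section NormTopology.
Set Implicit Arguments.
Unset Strict Implicit.
Local Open Scope complex_scope.
Variables (R : realType) (E : normedModType R[i]).

Lemma nbhs_nrm (x : E) (P : set E) :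
  nbhs x P <-> exists2 e : R, 0 < e & forall y, nrm (x - y) < e -> P y.
Proof.
split=> [/nbhs_normP[e /= e0 h]|[e e0 h]].
  have eE : e = (complex.Re e)%:C.
    by have := e0; case: (e) => a b; rewrite ltcE/= => /andP[/eqP ->].
  exists (complex.Re e) => [|y xy]; first by rewrite -ltcR -eE.
  by apply: h; rewrite /= /ball_/= normE eE ltcR.
apply/nbhs_normP; exists e%:C; first by rewrite /= ltcR.
by move=> y /=; rewrite /ball_/= normE ltcR; exact: h.
Qed.

Lemma closure_nrm (S : set E) (x : E) :
  closure S x <-> forall e : R, 0 < e -> exists2 y, S y & nrm (x - y) < e.
Proof.
split=> [cl e e0|h B /nbhs_nrm[e e0 hB]].
  have /cl[y [Sy xy]] : nbhs x [set y | nrm (x - y) < e].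
    by apply/nbhs_nrm; exists e.
  by exists y.
by have [y Sy xy] := h e e0; exists y; split => //; exact: hB.
Qed.

Lemma dense_nrm (S : set E) (x : E) (e : R) :
  dense S -> 0 < e -> exists2 y, S y & nrm (x - y) < e.
Proof.
move=> dS; apply: (proj1 (closure_nrm S x)) => B.
rewrite nbhsE => -[V [oV Vx] VB].
have [|y [Vy Sy]] := dS V _ oV; first by exists x.
by exists y; split => //; exact: VB.
Qed.

End NormTopology.

(** The filter is arbitrary because completeness is used both for ordinary sequences and along
    ultrafilters. *)
Lemma nrm_cauchy_lim (R : realType) (E : completeNormedModType R[i])
    (F : set_system nat) (FF : ProperFilter F) (u : nat -> E) :
  (forall e : R, 0 < e -> exists2 S : set nat, F S &
     forall i j, S i -> S j -> nrm (u i - u j) <= e) ->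
  exists l : E, forall e : R, 0 < e -> F [set n | nrm (u n - l) <= e].
Proof.
move=> h.
have uc : cauchy (u @ F).
  apply/cauchy_exP => e e0; rewrite /cauchy_ex.
  have /nbhs_nrm[d d0 hd] : nbhs (0 : E) (ball 0 e) by exact: nbhsx_ballx.
  have d2 : 0 < d / 2 by rewrite divr_gt0.
  have [S FS hS] := h _ d2.
  have [i Si] := filter_ex FS.
  exists (u i); rewrite /nbhs/=; apply: filterS FS => j Sj /=.
  rewrite -ball_normE /ball_ /=; have := hd (u j - u i).
  rewrite -ball_normE /ball_ /= !sub0r !normrN nrmN distrC; apply.
  by apply: (le_lt_trans (hS _ _ Sj Si)); rewrite ltr_pdivrMr// ltr_pMr// ltr1n.
have /cvg_ex[/= l ul] : cvg (u @ F) by apply: cauchy_cvg.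
exists l => e e0; have := ul [set y | nrm (y - l) <= e]; apply.
by apply/nbhs_nrm; exists e => // y ly /=; rewrite nrmC ltW.
Qed.

(** * Geometry of the Hilbert space and orthonormal expansions *)

Section HilbertSpace.
Set Implicit Arguments.
Unset Strict Implicit.
Local Open Scope complex_scope.
Variables (R : realType) (H : completeNormedModType R[i]).
Variable dot : {dot H for Num.conj}.
Hypothesis dot_norm : inner_product_norm dot.
Implicit Types (x y z : H) (a : R[i]).

Lemma dotDl x y z : dot (x + y) z = dot x z + dot y z.
Proof. exact: linearDl. Qed.
Lemma dotBl x y z : dot (x - y) z = dot x z - dot y z.
Proof. exact: linearBl. Qed.
Lemma dotZl a x z : dot (a *: x) z = a * dot x z.
Proof. exact: linearZl_LR. Qed.
Lemma dot0l z : dot 0 z = 0.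
Proof. exact: linear0l. Qed.
Lemma dotDr x y z : dot x (y + z) = dot x y + dot x z.
Proof. exact: linearDr. Qed.
Lemma dotBr x y z : dot x (y - z) = dot x y - dot x z.
Proof. exact: linearBr. Qed.
Lemma dotZr a x z : dot x (a *: z) = Num.conj a * dot x z.
Proof. exact: linearZr_LR. Qed.
Lemma dot0r z : dot z 0 = 0.
Proof. exact: linear0r. Qed.
Lemma dot_suml (I : Type) (r : seq I) (P : pred I) (h : I -> H) z :
  dot (\sum_(i <- r | P i) h i) z = \sum_(i <- r | P i) dot (h i) z.
Proof. exact: linear_sumlz. Qed.
Lemma dot_sumr (I : Type) (r : seq I) (P : pred I) (h : I -> H) z :
  dot z (\sum_(i <- r | P i) h i) = \sum_(i <- r | P i) dot z (h i).
Proof. exact: linear_sumr. Qed.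
Lemma dotC x y : dot x y = Num.conj (dot y x).
Proof. by rewrite hermC expr0 mul1r. Qed.

Lemma dotxx x : dot x x = (nrm x ^+ 2)%:C.
Proof. by rewrite -dot_norm normE rmorphXn. Qed.

Lemma nrm_conj a : nrm (Num.conj a) = nrm a.
Proof. by rewrite /nrm norm_conjC. Qed.

Lemma conj_mul_self a : Num.conj a * a = (nrm a ^+ 2)%:C.
Proof. by rewrite mulrC -normCK normE rmorphXn. Qed.

(** Cauchy-Schwarz, from the nonnegative squared norm of [x] minus its projection on the line of
    [y]. *)
Lemma nrm_dot x y : nrm (dot x y) <= nrm x * nrm y.
Proof.
have [->|y0] := eqVneq y 0; first by rewrite dot0r !nrm0 mulr0.
have ny : 0 < nrm y by exact: nrm_gt0.
set c := dot x y; pose d := c / (nrm y ^+ 2)%:C.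
have y2 : (nrm y ^+ 2)%:C != 0 by rewrite eq_complex /= eqxx andbT sqrf_eq0 gt_eqF.
have : 0 <= dot (x - d *: y) (x - d *: y) by rewrite dotxx ler0c sqr_ge0.
rewrite dotBr dotZr [dot _ y]dotBl dotZl dotxx -/c /d divfK// subrr mulr0 subr0.
rewrite dotBl dotZl (dotC y x) -/c dotxx.
rewrite mulrAC [c * _]mulrC conj_mul_self -fmorphV -rmorphM -rmorphB/= ler0c.
rewrite subr_ge0 ler_pdivrMr ?exprn_gt0// -exprMn.
by rewrite ler_sqr// ?nnegrE ?mulr_ge0 ?nrm_ge0.
Qed.

Lemma nrm_sqD x y :
  nrm (x + y) ^+ 2 = nrm x ^+ 2 + nrm y ^+ 2 + 2 * complex.Re (dot x y).
Proof.
have : dot (x + y) (x + y) = dot x x + dot y y + (dot x y + Num.conj (dot x y)).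
  by rewrite dotDl !dotDr -(dotC y x); ring.
rewrite !dotxx; case: (dot x y) => u v; move=> /(congr1 (@complex.Re R)) /=.
by move=> ->; ring.
Qed.

Lemma nrm_sqD_orth x y : dot x y = 0 -> nrm (x + y) ^+ 2 = nrm x ^+ 2 + nrm y ^+ 2.
Proof. by move=> h; rewrite nrm_sqD h /= mulr0 addr0. Qed.

Lemma parallelogram x y :
  nrm (x + y) ^+ 2 + nrm (x - y) ^+ 2 = 2 * (nrm x ^+ 2 + nrm y ^+ 2).
Proof.
rewrite !nrm_sqD nrmN (_ : dot x (- y) = - dot x y); last exact: linearNr.
by case: (dot x y) => u v /=; ring.
Qed.

Lemma nrm_le_sqr (a b : R) : 0 <= b -> a ^+ 2 <= b ^+ 2 -> a <= b.
Proof. by move=> b0 h; nra. Qed.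

Lemma dot_eqr y z : (forall x, dot x y = dot x z) -> y = z.
Proof.
move=> h; apply/eqP; rewrite -subr_eq0; apply/eqP/nrm_eq0.
have : dot (y - z) (y - z) = 0 by rewrite dotBr h subrr.
by rewrite dotxx => /(congr1 (@complex.Re R)) /= /eqP; rewrite sqrf_eq0 => /eqP.
Qed.

Section Basis.
Variable g : nat -> H.
Hypothesis gB : orthonormal_basis dot g.

Lemma dot_basis j k : dot (g j) (g k) = (j == k)%:R.
Proof. exact: (proj1 gB). Qed.

Lemma nrm_basis j : nrm (g j) = 1.
Proof.
have := dotxx (g j); rewrite dot_basis eqxx => /(congr1 (@complex.Re R)) /= /esym/eqP.
by rewrite sqrf_eq1 => /orP[/eqP //|/eqP h]; have := nrm_ge0 (g j); rewrite h ler0N1.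
Qed.

Definition psum (c : nat -> R[i]) n : H := \sum_(j < n) c j *: g j.

Lemma psumS c n : psum c n.+1 = psum c n + c n *: g n.
Proof. by rewrite /psum big_ord_recr. Qed.

Lemma dot_psum c n k : dot (psum c n) (g k) = if (k < n)%N then c k else 0.
Proof.
elim: n => [|n IH]; first by rewrite /psum big_ord0 dot0l.
rewrite psumS dotDl IH dotZl dot_basis ltnS.
by case: (ltngtP k n) => kn; rewrite ?mulr0 ?addr0// -kn ?mulr1 ?add0r.
Qed.

Lemma nrm_psumS c n : nrm (psum c n.+1) ^+ 2 = nrm (psum c n) ^+ 2 + nrm (c n) ^+ 2.
Proof.
rewrite psumS nrm_sqD_orth ?nrmZ ?nrm_basis ?mulr1//.
by rewrite dotZr dot_psum ltnn mulr0.
Qed.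

Lemma psum_shift c n m :
  nrm (psum c (n + m)) ^+ 2 = nrm (psum c n) ^+ 2 + nrm (psum c (n + m) - psum c n) ^+ 2.
Proof.
rewrite -nrm_sqD_orth; first by rewrite addrC subrK.
elim: m => [|m IH]; first by rewrite addn0 subrr dot0r.
rewrite addnS psumS addrAC dotDr IH dotZr dot_psum.
by rewrite ltnNge leq_addr mulr0 addr0.
Qed.

(** By Pythagoras the squared norms increase, and the increment of the squares is the square of the
    distance. Past an index where the square is within [(e/2)^2] of its supremum, the sums stay
    within [e/2] of each other. *)
Lemma psum_cvg c (C : R) : (forall n, nrm (psum c n) <= C) ->
  exists y, forall e : R, 0 < e ->
    exists N, forall n, (N <= n)%N -> nrm (psum c n - y) <= e.
Proof.
move=> hC; pose S := range (fun n => nrm (psum c n) ^+ 2).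
have C0 : 0 <= C by apply: le_trans (hC 0); exact: nrm_ge0.
have supS : has_sup S.
  split; first by exists (nrm (psum c 0) ^+ 2), 0.
  exists (C ^+ 2) => _ [n _ <-]; rewrite ler_sqr// nnegrE//; exact: nrm_ge0.
have [] := @nrm_cauchy_lim _ H \oo _ (psum c).
  move=> e e0; have e2 : 0 < (e/2) ^+ 2 by rewrite exprn_gt0// divr_gt0.
  have [_ [N _ <-] hN] := sup_adherent e2 supS.
  have hd n : (N <= n)%N -> nrm (psum c n - psum c N) <= e / 2.
    move=> Nn; apply: nrm_le_sqr; first by rewrite divr_ge0// ltW.
    have := psum_shift c N (n - N); rewrite subnKC// => hh.
    have : nrm (psum c n) ^+ 2 <= sup S.
      by apply: ub_le_sup; [exact: supS.2|exists n].
    lra.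
  exists [set n | (N <= n)%N]; first by exists N.
  move=> i j /= Ni Nj; apply: (le_trans (nrm_dist (psum c N) _ _)).
  rewrite (nrmC (psum c N)); have := hd _ Ni; have := hd _ Nj; lra.
move=> y hy; exists y => e e0; have [N _ hN] := hy e e0.
by exists N => n Nn; exact: hN.
Qed.

Definition oproj x n := psum (fun j => dot x (g j)) n.

Lemma oprojD a x y n : oproj (a *: x + y) n = a *: oproj x n + oproj y n.
Proof.
rewrite /oproj /psum scaler_sumr -big_split/=; apply: eq_bigr => j _.
by rewrite scalerA -scalerDl dotDl dotZl.
Qed.

Lemma oprojB x y n : oproj (x - y) n = oproj x n - oproj y n.
Proof. by rewrite addrC -scaleN1r oprojD scaleN1r addrC. Qed.

Lemma bessel_eq x n : nrm x ^+ 2 = nrm (oproj x n) ^+ 2 + nrm (x - oproj x n) ^+ 2.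
Proof.
rewrite -nrm_sqD_orth; first by rewrite addrC subrK.
rewrite dot_suml big1// => j _; rewrite dotZl [dot (g j) _]dotC dotBl dot_psum ltn_ord.
by rewrite subrr rmorph0 mulr0.
Qed.

Lemma nrm_oproj x n : nrm (oproj x n) <= nrm x.
Proof.
by apply: nrm_le_sqr; rewrite ?nrm_ge0// (bessel_eq x n) lerDl sqr_ge0.
Qed.

Lemma nrm_oproj_compl x n : nrm (x - oproj x n) <= nrm x.
Proof.
by apply: nrm_le_sqr; rewrite ?nrm_ge0// (bessel_eq x n) lerDr sqr_ge0.
Qed.

(** The vectors fixed by all late projections form a subspace containing the basis, hence its span.
    The span is dense and the complementary projections are contractions, so the error at [x] is at
    most its distance to such a vector. *)
Lemma oproj_cvg x (e : R) : 0 < e ->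
  exists N, forall n, (N <= n)%N -> nrm (x - oproj x n) <= e.
Proof.
move=> e0; have e2 : 0 < e / 2 by rewrite divr_gt0.
have : closure (linear_span (range g)) x by rewrite (proj2 gB).
move=> /closure_nrm /(_ _ e2)[z zs xz].
pose S := [set z | exists N, forall n, (N <= n)%N -> oproj z n = z].
have Sz : S z.
  apply: zs; split; last first.
    move=> _ [k _ <-]; exists k.+1 => n kn.
    apply: dot_eqr => u; rewrite dotC [RHS]dotC; congr Num.conj.
    rewrite dot_suml (bigD1 (Ordinal kn))//= dot_basis eqxx scale1r.
    rewrite big1 ?addr0// => j jk; rewrite dot_basis.
    by rewrite eq_sym -(inj_eq val_inj)/= in jk; rewrite (negPf jk) scale0r dot0l.
  split; first by exists 0%N => n _; rewrite /oproj /psum big1// => j _; rewrite dot0l scale0r.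
  move=> a u v [N1 h1] [N2 h2]; exists (maxn N1 N2) => n.
  by rewrite geq_max => /andP[n1 n2]; rewrite oprojD h1// h2.
have [N hN] := Sz; exists N => n /hN hn.
have -> : x - oproj x n = (x - z) - oproj (x - z) n.
  by rewrite oprojB hn opprB addrA subrK.
by apply: (le_trans (nrm_oproj_compl _ _)); lra.
Qed.

End Basis.
End HilbertSpace.

(** * Riesz representation, orthogonality and finite rank operators *)

Section FiniteRank.
Set Implicit Arguments.
Unset Strict Implicit.
Local Open Scope complex_scope.
Variables (R : realType) (H : completeNormedModType R[i]).
Variable dot : {dot H for Num.conj}.
Hypothesis dot_norm : inner_product_norm dot.
Variable g : nat -> H.
Hypothesis gB : orthonormal_basis dot g.
Implicit Types (x y z : H) (A B F : H -> H).

Lemma bounded_opP A : bounded_operators H A <->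
  linear A /\ exists2 C : R, 0 <= C & forall x, nrm (A x) <= C * nrm x.
Proof.
split=> -[linA].
  move=> [c hc]; split => //; exists `|c| => // x.
  have := hc x; rewrite !normE -rmorphM lecR => /le_trans; apply.
  by rewrite ler_wpM2r ?nrm_ge0// ler_norm.
move=> [c c0 hc]; split => //; exists c => x.
by rewrite !normE -rmorphM lecR.
Qed.

(** The representing vector has coordinates [c j], the conjugates of [f (g j)]. A partial sum [p] of
    it satisfies [f p = |p|^2], which forces [|p|] to be at most [|C|]; so the partial sums
    converge. *)
Lemma riesz (f : H -> R[i]) (C : R) : scalar f ->
  (forall x, nrm (f x) <= C * nrm x) -> exists a, forall x, f x = dot x a.
Proof.
move=> linf hC; pose c j := Num.conj (f (g j)).
have fpsum d n : f (psum g d n) = \sum_(j < n) d j * f (g j).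
  elim: n => [|n IH].
    rewrite /psum !big_ord0; have := linf (-1) 0 0.
    by rewrite scaler0 addr0 mulN1r addNr.
  by rewrite psumS addrC linf IH big_ord_recr/= addrC.
have npsum n : \sum_(j < n) c j * f (g j) = (nrm (psum g c n) ^+ 2)%:C.
  elim: n => [|n IH]; first by rewrite /psum !big_ord0 nrm0 expr0n.
  rewrite big_ord_recr/= IH (nrm_psumS dot_norm gB) rmorphD/=.
  by rewrite /c conj_mul_self nrm_conj.
have bnd n : nrm (psum g c n) <= `|C|.
  have := hC (psum g c n); rewrite fpsum npsum nrm_real ger0_norm ?sqr_ge0//.
  have := nrm_ge0 (psum g c n); have := ler_norm C.
  set u := nrm _; set K := `|C|; have K0 : 0 <= K by exact: normr_ge0.
  move=> CK u0 h; rewrite leNgt; apply/negP => Ku; have : C * u < u ^+ 2 by nra.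
  lra.
have [a ha] := psum_cvg dot_norm gB bnd.
exists a => x; apply/eqP; rewrite -subr_eq0; apply/eqP.
apply: (@nrm_small_eq0 _ _ _ (`|C| + nrm x)) => e e0.
have [N1 h1] := ha e e0; have [N2 h2] := oproj_cvg dot_norm gB x e0.
pose n := maxn N1 N2.
have {}h1 := h1 n (leq_maxl _ _); have {}h2 := h2 n (leq_maxr _ _).
have -> : f x - dot x a = f (x - oproj dot g x n) + dot x (psum g c n - a).
  have -> : f (x - oproj dot g x n) = f x - f (oproj dot g x n).
    by rewrite addrC -scaleN1r linf mulN1r addrC.
  rewrite dotBr addrA; congr (_ - _); rewrite -addrA [X in _ + X](_ : _ = 0) ?addr0//.
  rewrite fpsum dot_sumr addrC; apply/eqP; rewrite subr_eq0; apply/eqP.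
  by apply: eq_bigr => j _; rewrite dotZr /c conjCK mulrC.
apply: (le_trans (nrmD _ _)); rewrite mulrDr; apply: lerD.
  apply: (le_trans (hC _)); apply: le_trans (_ : `|C| * nrm (x - oproj dot g x n) <= _).
    by rewrite ler_wpM2r ?nrm_ge0// ler_norm.
  by rewrite mulrC ler_wpM2r.
apply: (le_trans (nrm_dot dot_norm _ _)).
by rewrite mulrC ler_wpM2r// nrm_ge0.
Qed.

Lemma subspaceZ (Z : set H) (a : R[i]) x : is_subspace Z -> Z x -> Z (a *: x).
Proof. by move=> [Z0 hZ] Zx; rewrite -[_ *: _]addr0; exact: hZ. Qed.

Lemma subspaceD (Z : set H) x y : is_subspace Z -> Z x -> Z y -> Z (x + y).
Proof. by move=> [_ hZ] Zx Zy; rewrite -[x]scale1r; exact: hZ. Qed.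

(* If [d] is the distance from [v] to [Z], a minimizing sequence in [Z] is
   Cauchy by the parallelogram identity, and [v] minus its limit is orthogonal
   to [Z]. *)
Lemma orthogonal_trivial_dense (Z : set H) : is_subspace Z ->
  (forall h, (forall z, Z z -> dot h z = 0) -> h = 0) -> forall v, closure Z v.
Proof.
move=> sZ hZ v; pose D := [set nrm (v - z) | z in Z].
have infD : has_inf D.
  split; first by exists (nrm (v - 0)), 0 => //; exact: sZ.1.
  by exists 0 => _ [z _ <-]; exact: nrm_ge0.
pose d := inf D.
have d0 : 0 <= d.
  by apply: lb_le_inf; [exact: infD.1|move=> _ [z _ <-]; exact: nrm_ge0].
have hd z : Z z -> d <= nrm (v - z).
  by move=> Zz; apply: ge_inf; [exact: infD.2|exists z].
have /choice[u hu] (n : nat) : exists z, Z z /\ nrm (v - z) <= d + n.+1%:R^-1.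
  have n0 : 0 < n.+1%:R^-1 :> R by rewrite invr_gt0 ltr0n.
  have [_ [z Zz <-] hz] := inf_adherent n0 infD.
  by exists z; split => //; exact: ltW.
have small (e : R) : 0 < e -> exists N : nat, forall n, (N <= n)%N -> n.+1%:R^-1 <= e.
  move=> e0; exists (Num.trunc e^-1) => n Nn.
  rewrite -[e]invrK lef_pV2 ?posrE ?ltr0n ?invr_gt0//.
  apply: ltW; apply: lt_le_trans (truncnS_gt _) _.
  by rewrite ler_nat ltnS.
have [|l hl] := @nrm_cauchy_lim _ H \oo _ u.
  move=> e e0.
  (* When both distances are at most [d + q], the parallelogram identity and the midpoint, at
     distance at least [d], bound the squared gap by [4 (d + q)^2 - 4 d^2], which is at most
     [(8 d + 4) q] as [q <= 1]. *)
  pose q := Num.min 1 (e ^+ 2 / (8 * d + 4)).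
  have q0 : 0 < q by rewrite lt_min ltr01 divr_gt0 ?exprn_gt0//; lra.
  have [N hN] := small _ q0.
  exists [set n | (N <= n)%N]; first by exists N.
  move=> i j /= /hN Ni /hN Nj.
  have q1 : q <= 1 by rewrite ge_min lexx.
  have q2 : q * (8 * d + 4) <= e ^+ 2.
    by rewrite -ler_pdivlMr ?ge_min ?lexx ?orbT//; lra.
  apply: nrm_le_sqr; first exact: ltW.
  have := parallelogram dot_norm (v - u i) (v - u j).
  have -> : v - u i - (v - u j) = u j - u i by rewrite opprB addrC addrA subrK.
  have -> : v - u i + (v - u j) = (2%:C) *: (v - (2^-1)%:C *: (u i + u j)).
    rewrite scalerBr scalerA -rmorphM/= divff ?pnatr_eq0// scale1r.
    by rewrite (_ : 2%:C = 1 + 1) ?scalerDl ?scale1r 1?addrACA ?opprD// rmorphD.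
  rewrite nrmZR// [nrm (u j - u i)]nrmC.
  have : d <= nrm (v - (2^-1)%:C *: (u i + u j)).
    apply: hd; apply: subspaceZ => //; apply: subspaceD => //; by case: (hu i); case: (hu j).
  have : nrm (v - u i) <= d + q by apply: (le_trans (hu i).2); rewrite lerD2l.
  have : nrm (v - u j) <= d + q by apply: (le_trans (hu j).2); rewrite lerD2l.
  have := nrm_ge0 (v - u i); have := nrm_ge0 (v - u j).
  set t := nrm (v - _ *: _); set m := nrm (v - u i); set k := nrm (v - u j).
  move=> k0 m0 hk hm ht.
  have : m ^+ 2 <= (d + q) ^+ 2 by nra.
  have : k ^+ 2 <= (d + q) ^+ 2 by nra.
  have : d ^+ 2 <= t ^+ 2 by nra.
  nra.
have hnear (e : R) : 0 < e -> exists2 z, Z z & nrm (v - z) <= d + e /\ nrm (z - l) <= e.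
  move=> e0; have [N1 h1] := small _ e0; have [N2 _ h2] := hl _ e0.
  pose n := maxn N1 N2; exists (u n); first exact: (hu n).1.
  split; last by apply: h2; exact: leq_maxr.
  apply: (le_trans (hu n).2); rewrite lerD2l; apply: h1; exact: leq_maxl.
have hle : nrm (v - l) <= d.
  apply/ler_addgt0Pr => e e0; have e2 : 0 < e / 2 by rewrite divr_gt0.
  have [z Zz [h1 h2]] := hnear _ e2.
  apply: (le_trans (nrm_dist z _ _)); lra.
have hge z : Z z -> d <= nrm (v - l - z).
  move=> Zz; apply/ler_addgt0Pr => e e0.
  have [z' Zz' [h1 h2]] := hnear _ e0.
  have := hd _ (subspaceD sZ Zz' Zz); rewrite opprD addrA => /le_trans; apply.
  have -> : v - z' - z = (v - l - z) + (l - z').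
    by rewrite [RHS]addrAC addrA subrK.
  apply: (le_trans (nrmD _ _)); rewrite lerD2l nrmC; exact: h2.
have vl : v - l = 0.
  apply: hZ => z Zz.
  have [->|z0] := eqVneq z 0; first by rewrite dot0r.
  (* Subtracting the projection [t *: z] from [v - l] cannot bring the norm below [d], and [v - l]
     has norm at most [d]; Pythagoras leaves no room for [t *: z]. *)
  pose t := dot (v - l) z / dot z z.
  have zz0 : dot z z != 0.
    by rewrite dotxx// eq_complex /= eqxx andbT sqrf_eq0 gt_eqF// nrm_gt0.
  have orth : dot (v - l - t *: z) z = 0.
    by rewrite dotBl dotZl /t divfK// subrr.
  have : nrm (v - l) ^+ 2 = nrm (v - l - t *: z) ^+ 2 + nrm (t *: z) ^+ 2.
    by rewrite -(nrm_sqD_orth dot_norm) ?subrK// dotZr orth mulr0.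
  have := hge _ (subspaceZ t sZ Zz).
  have := nrm_ge0 (v - l); have := nrm_ge0 (t *: z).
  move=> h1 h2 h3 h4.
  have /nrm_eq0 tz : nrm (t *: z) = 0 by nra.
  by have := orth; rewrite tz subr0.
apply/closure_nrm => e e0; have e2 : 0 < e / 2 by rewrite divr_gt0.
have [z Zz [_ h2]] := hnear _ e2; exists z => //.
move/eqP: vl; rewrite subr_eq0 => /eqP ->; rewrite nrmC; lra.
Qed.

(** A pair [(a, b)] of the list stands for the rank one operator sending [x] to [dot x a *: b]. No
    independence is asked, so that sums are concatenations, and boundedness is automatic. *)
Definition frank F : Prop := exists s : seq (H * H),
  forall x, F x = \sum_(p <- s) dot x p.1 *: p.2.

Lemma frank_bounded F : frank F -> bounded_operators H F.
Proof.
move=> [s hs]; apply/bounded_opP; split.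
  move=> a x y; rewrite !hs scaler_sumr -big_split/=.
  by apply: eq_bigr => p _; rewrite dotDl dotZl scalerDl scalerA.
exists (\sum_(p <- s) nrm p.1 * nrm p.2).
  by apply: sumr_ge0 => p _; rewrite mulr_ge0 ?nrm_ge0.
move=> x; rewrite hs mulr_suml; apply: (le_trans (nrm_sum _ _ _)).
apply: ler_sum => p _; rewrite nrmZ; have := nrm_dot dot_norm x p.1.
have := nrm_ge0 p.2; nra.
Qed.

Lemma frank0 : frank (fun=> 0).
Proof. by exists [::] => x; rewrite big_nil. Qed.

Lemma frankD F F' : frank F -> frank F' -> frank (fun x => F x + F' x).
Proof. by move=> [s hs] [t ht]; exists (s ++ t) => x; rewrite big_cat hs ht. Qed.

Lemma frank_compl A F : linear A -> frank F -> frank (A \o F).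
Proof.
move=> linA [s hs]; exists [seq (p.1, A p.2) | p <- s] => x.
by rewrite /= hs big_map linmap_sum//; apply: eq_bigr => p _; rewrite linmapZ.
Qed.

Lemma frankZ (a : R[i]) F : frank F -> frank (fun x => a *: F x).
Proof.
move=> [s hs]; exists [seq (p.1, a *: p.2) | p <- s] => x.
by rewrite hs big_map scaler_sumr; apply: eq_bigr => p _; rewrite /= !scalerA mulrC.
Qed.

(** Composition on the right moves [a] in [dot x a] to the image of [a] under the adjoint of [A],
    which Riesz supplies one vector at a time. *)
Lemma frank_compr A F : bounded_operators H A -> frank F -> frank (F \o A).
Proof.
move=> /bounded_opP[linA [C C0 hA]] [s hs].
have /choice[f hf] (a : H) : exists a', forall x, dot (A x) a = dot x a'.
  apply: (@riesz _ (C * nrm a)).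
    by move=> c x y; rewrite linA dotDl dotZl.
  move=> x; apply: (le_trans (nrm_dot dot_norm _ _)).
  have := hA x; have := nrm_ge0 a; nra.
exists [seq (f p.1, p.2) | p <- s] => x.
by rewrite /= hs big_map; apply: eq_bigr => p _; rewrite /= hf.
Qed.

(** A bound on the essential norm of [A], that is, on its norm modulo compact operators, witnessed
    by a finite rank operator. *)
Definition near_fr A (e : R) : Prop :=
  exists2 F, frank F & forall x, nrm (A x - F x) <= e * nrm x.

Lemma near_fr_le A (e e' : R) : e <= e' -> near_fr A e -> near_fr A e'.
Proof.
move=> ee' [F fF h]; exists F => // x; apply: (le_trans (h x)).
by rewrite ler_wpM2r// nrm_ge0.
Qed.

Lemma near_frD A B (e e' : R) :
  near_fr A e -> near_fr B e' -> near_fr (fun x => A x + B x) (e + e').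
Proof.
move=> [F fF h] [G fG h']; exists (fun x => F x + G x); first exact: frankD.
move=> x; rewrite opprD addrACA mulrDl.
by apply: (le_trans (nrmD _ _)); exact: lerD.
Qed.

Lemma near_frZ (a : R[i]) A (e : R) : near_fr A e -> near_fr (fun x => a *: A x) (nrm a * e).
Proof.
move=> [F fF h]; exists (fun x => a *: F x); first exact: frankZ.
move=> x; rewrite -scalerBr nrmZ -mulrA ler_wpM2l ?nrm_ge0//; exact: h.
Qed.

(* AB - (FB + AG - FG) = (A - F)(B - G). *)
Lemma near_fr_comp A B (e e' : R) : linear A -> bounded_operators H B -> 0 <= e ->
  near_fr A e -> near_fr B e' -> near_fr (A \o B) (e * e').
Proof.
move=> linA bB e0 [F fF h] [G fG h'].
have [linF _] := frank_bounded fF.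
exists (fun x => (F (B x) + A (G x)) + (-1) *: F (G x)).
  apply: frankD; last by apply: frankZ; apply: (@frank_compl F G).
  by apply: frankD; [exact: (@frank_compr B F)|exact: (@frank_compl A G)].
move=> x; rewrite scaleN1r.
have -> : (A \o B) x - (F (B x) + A (G x) - F (G x)) =
          A (B x - G x) - F (B x - G x).
  rewrite /= (linmapB linA) (linmapB linF) !opprD !opprK !addrA.
  by rewrite (addrAC (A (B x))).
by apply: (le_trans (h _)); rewrite -mulrA ler_wpM2l.
Qed.

End FiniteRank.

(** * Limits along an ultrafilter *)

Section UltraLimits.
Set Implicit Arguments.
Unset Strict Implicit.
Local Open Scope complex_scope.
Variables (U : set_system nat) (UU : UltraFilter U).

(** The limit is the supremum of the [r] lying below [u n] for [U]-many [n]; above it, the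
    ultrafilter must choose the opposite inequality. *)
Lemma ultra_real (R : realType) (u : nat -> R) (C : R) :
  U [set n | `|u n| <= C] ->
  exists l, forall e : R, 0 < e -> U [set n | `|u n - l| <= e].
Proof.
move=> hC; pose S := [set r | U [set n | r <= u n]].
have supS : has_sup S.
  split.
    exists (- C); apply: filterS hC => n /=; rewrite ler_norml => /andP[].
    by [].
  exists C => r Sr; have [n /= [h1 h2]] := filter_ex (filterI hC Sr).
  exact: le_trans h2 (le_trans (ler_norm _) h1).
exists (sup S) => e e0.
have [r Sr hr] := sup_adherent e0 supS.
have hl : U [set n | u n < sup S + e].
  have [h|h] := in_ultra_setVsetC [set n | sup S + e <= u n] UU.
    have : sup S + e <= sup S by apply: ub_le_sup => //; exact: supS.2.
    by rewrite gerDl leNgt e0.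
  by apply: filterS h => n /= /negP; rewrite -ltNge.
apply: filterS2 Sr hl => n /= h1 h2; rewrite ler_norml; apply/andP; split; lra.
Qed.

Lemma ultra_complex (R : realType) (u : nat -> R[i]) (C : R) :
  U [set n | nrm (u n) <= C] ->
  exists l, forall e : R, 0 < e -> U [set n | nrm (u n - l) <= e].
Proof.
move=> hC.
have [|a ha] := @ultra_real R (fun n => complex.Re (u n)) C.
  by apply: filterS hC => n /=; apply: le_trans; exact: nrm_Re.
have [|b hb] := @ultra_real R (fun n => complex.Im (u n)) C.
  by apply: filterS hC => n /=; apply: le_trans; exact: nrm_Im.
exists (a +i* b) => e e0; have e2 : 0 < e / 2 by rewrite divr_gt0.
apply: filterS2 (ha _ e2) (hb _ e2) => n /=; case: (u n) => c d /= h1 h2.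
apply: (le_trans (nrm_ReIm _)) => /=; lra.
Qed.

Lemma ultra_pick (I : finType) (f : nat -> I) : exists i, U [set n | f n = i].
Proof.
apply: contrapT => /forallNP h.
have : forall s : seq I, U [set n | f n \notin s].
  elim=> [|i s IH]; first by apply: filterS filterT => n.
  have [/h //|hi] := in_ultra_setVsetC [set n | f n = i] UU.
  apply: filterS2 IH hi => n /= h1 h2; rewrite inE negb_or h1 andbT.
  exact/eqP.
move=> /(_ (enum I)) /filter_ex[n /=].
by rewrite mem_enum.
Qed.

(** A substitute for diagonal extraction: each position gets its own [U]-majority letter, and
    finitely many positions agree simultaneously on a set of [U]. *)
Lemma ultra_pick_seq (I : finType) (f : nat -> nat -> I) :
  exists p : nat -> I, forall l, U [set n | forall i, (i < l)%N -> f n i = p i].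
Proof.
have [p hp] := choice (fun i => ultra_pick (f ^~ i)).
exists p => l; elim: l => [|l IH]; first by apply: filterS filterT.
apply: filterS2 IH (hp l) => n /= h1 h2 i; rewrite ltnS leq_eqVlt.
by case/orP => [/eqP ->//|]; exact: h1.
Qed.

Variables (R : realType) (H : completeNormedModType R[i]).
Implicit Types (W X : nat -> H -> H) (A L F : H -> H).

Definition ulim W L : Prop :=
  forall e : R, 0 < e -> U [set n | forall x, nrm (W n x - L x) <= e * nrm x].

Definition ucauchy W : Prop := forall e : R, 0 < e -> exists2 S, U S &
  forall i j, S i -> S j -> forall x, nrm (W i x - W j x) <= e * nrm x.

Lemma ucauchy_ulim W : (forall n, linear (W n)) -> ucauchy W ->
  exists2 L, linear L & ulim W L.
Proof.
move=> linW cW.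
have /choice[L hL] (x : H) : exists y, forall e : R, 0 < e ->
    U [set n | nrm (W n x - y) <= e].
  apply: (@nrm_cauchy_lim _ H U _ (fun n => W n x)) => e e0.
  have x1 : 0 < nrm x + 1 by rewrite ltr_wpDl// nrm_ge0.
  have e1 : 0 < e / (nrm x + 1) by rewrite divr_gt0.
  have [S US hS] := cW _ e1; exists S => // i j Si Sj.
  apply: (le_trans (hS _ _ Si Sj x)); rewrite mulrAC ler_pdivrMr// ler_pM2l//.
  by rewrite lerDl.
exists L.
  move=> a x y; apply/eqP; rewrite -subr_eq0; apply/eqP.
  apply: (@nrm_small_eq0 _ _ _ (2 + nrm a)) => e e0.
  have [n [[/= h1 h2] h3]] :=
    filter_ex (filterI (filterI (hL x _ e0) (hL y _ e0)) (hL (a *: x + y) _ e0)).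
  rewrite (_ : _ - _ = (L (a *: x + y) - W n (a *: x + y)) +
     (a *: (W n x - L x) + (W n y - L y))); last first.
    by rewrite linW scalerBr [X in _ = _ + X]addrACA -opprD addrA subrK.
  apply: (le_trans (nrmD _ _)); have := nrmD (a *: (W n x - L x)) (W n y - L y).
  rewrite nrmZ; have := nrm_ge0 a; rewrite (nrmC (L _)); nra.
move=> e e0; have e2 : 0 < e / 2 by rewrite divr_gt0.
have [S US hS] := cW _ e2; apply: (filterS _ US) => n Sn x.
apply/ler_addgt0Pr => d d0; have [m [/= Sm hm]] := filter_ex (filterI US (hL x _ d0)).
apply: (le_trans (nrm_dist (W m x) _ _)); have := hS _ _ Sn Sm x.
have := nrm_ge0 x; nra.
Qed.

Lemma ulim_bound W L (C : R) : ulim W L ->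
  U [set n | forall x, nrm (W n x) <= C * nrm x] ->
  forall x, nrm (L x) <= C * nrm x.
Proof.
move=> hL hC x; apply: (@nrm_small_le _ _ _ _ (nrm x)) => // e e0.
have [n [/= h1 h2]] := filter_ex (filterI (hL _ e0) hC).
have := h1 x; have := h2 x; have := nrmBB (L x) (W n x); rewrite nrmC; lra.
Qed.

Lemma ucauchy0 : ucauchy (fun _ _ => 0).
Proof.
move=> e e0; exists setT; first exact: filterT.
by move=> i j _ _ x; rewrite subrr nrm0 mulr_ge0 ?nrm_ge0// ltW.
Qed.

Lemma ucauchyD W X : ucauchy W -> ucauchy X -> ucauchy (fun n x => W n x + X n x).
Proof.
move=> hW hX e e0; have e2 : 0 < e / 2 by rewrite divr_gt0.
have [S US hS] := hW _ e2; have [S' US' hS'] := hX _ e2.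
exists (S `&` S'); first exact: filterI.
move=> i j [Si Si'] [Sj Sj'] x; rewrite opprD addrACA.
apply: (le_trans (nrmD _ _)); have := hS _ _ Si Sj x; have := hS' _ _ Si' Sj' x.
lra.
Qed.

Lemma ucauchy_sum (T : Type) (s : seq T) (W : T -> nat -> H -> H) :
  (forall p, ucauchy (W p)) -> ucauchy (fun n x => \sum_(p <- s) W p n x).
Proof.
move=> hW; elim: s => [|p s IH].
  have -> : (fun n x => \sum_(p <- [::]) W p n x) = (fun _ _ => 0).
    by apply/funext => n; apply/funext => x; rewrite big_nil.
  exact: ucauchy0.
have -> : (fun n x => \sum_(p <- p :: s) W p n x) =
    (fun n x => W p n x + \sum_(p <- s) W p n x).
  by apply/funext => n; apply/funext => x; rewrite big_cons.
exact: ucauchyD.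
Qed.

Variable dot : {dot H for Num.conj}.
Hypothesis dot_norm : inner_product_norm dot.

(* [X |-> F X F'] is compact when [F] and [F'] have finite rank. *)
Lemma ucauchy_frank X F F' (M : R) : (forall n, linear (X n)) ->
  U [set n | forall x, nrm (X n x) <= M * nrm x] ->
  frank dot F -> frank dot F' -> ucauchy (fun n x => F (X n (F' x))).
Proof.
move=> linX hM [s hs] [t ht].
have -> : (fun n x => F (X n (F' x))) = (fun n x => \sum_(p <- s) \sum_(q <- t)
    (dot x q.1 * dot (X n q.2) p.1) *: p.2).
  apply/funext => n; apply/funext => x; rewrite hs; apply: eq_bigr => p _.
  rewrite ht (linmap_sum (linX n)) dot_suml scaler_suml; apply: eq_bigr => q _.
  by rewrite (linmapZ (linX n)) dotZl.
apply: ucauchy_sum => p; apply: ucauchy_sum => q e e0.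
(* In the expanded double sum only the scalars [dot (X n q.2) p.1] depend on [n], and they are
   bounded. *)
have [|l hl] := @ultra_complex R (fun n => dot (X n q.2) p.1) (M * nrm q.2 * nrm p.1).
  apply: filterS hM => n hn /=; apply: (le_trans (nrm_dot dot_norm _ _)).
  by rewrite ler_wpM2r ?nrm_ge0.
set K := nrm q.1 * nrm p.2.
have K0 : 0 <= K by rewrite mulr_ge0 ?nrm_ge0.
have d0 : 0 < e / (2 * (K + 1)) by rewrite divr_gt0// mulr_gt0// ltr_wpDl.
exists [set n | nrm (dot (X n q.2) p.1 - l) <= e / (2 * (K + 1))]; first exact: hl.
move=> i j /= hi hj x; rewrite -scalerBl -mulrBr nrmZ nrmM.
have : nrm (dot (X i q.2) p.1 - dot (X j q.2) p.1) <= e / (K + 1).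
  apply: (le_trans (nrm_dist l _ _)); rewrite (nrmC l).
  apply: (le_trans (lerD hi hj)); have K1 : 0 < K + 1 by rewrite ltr_wpDl.
  move: (K + 1) K1 => k k0; rewrite (_ : _ + _ = e / k)//.
  by field; rewrite gt_eqF.
set D := nrm (_ - _) => hD.
have D0 : 0 <= D by exact: nrm_ge0.
have : D * K <= e.
  apply: (@le_trans _ _ (D * (K + 1))); first by rewrite ler_wpM2l// lerDl.
  by rewrite -ler_pdivlMr// ltr_wpDl.
have := nrm_dot dot_norm x q.1; rewrite /K.
set a := nrm (dot x q.1); set b := nrm x; set c := nrm q.1; set d := nrm p.2.
have b0 : 0 <= b by exact: nrm_ge0.
have dd : 0 <= d by exact: nrm_ge0.
move=> h1 h2; apply: (@le_trans _ _ (b * c * D * d)).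
  by rewrite ler_wpM2r// ler_wpM2r.
rewrite (_ : b * c * D * d = D * (c * d) * b); last by ring.
by rewrite ler_wpM2r.
Qed.

Variable g : nat -> H.
Hypothesis gB : orthonormal_basis dot g.

(** Weak compactness of balls: the scalars [dot z (u n)] have limits along [U], which form a bounded
    linear functional of [z], represented by [y]. *)
Lemma weak_ulim (u : nat -> H) (C : R) : (forall n, nrm (u n) <= C) ->
  exists y, forall z (e : R), 0 < e -> U [set n | nrm (dot (u n - y) z) <= e].
Proof.
move=> hC.
have /choice[L hL] (z : H) : exists l : R[i], forall e : R, 0 < e ->
    U [set n | nrm (dot z (u n) - l) <= e].
  apply: (@ultra_complex R _ (nrm z * C)); apply: filterS filterT => n _ /=.
  apply: (le_trans (nrm_dot dot_norm _ _)).
  by apply: ler_wpM2l; [exact: nrm_ge0|exact: hC].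
have [|z|y hy] := @riesz R H dot dot_norm g gB L C.
- move=> a x z; apply/eqP; rewrite -subr_eq0; apply/eqP.
  apply: (@nrm_small_eq0 _ _ _ (2 + nrm a)) => e e0.
  have [n [[/= h1 h2] h3]] :=
    filter_ex (filterI (filterI (hL x _ e0) (hL z _ e0)) (hL (a *: x + z) _ e0)).
  rewrite (_ : _ - _ = (L (a *: x + z) - dot (a *: x + z) (u n)) +
     (a * (dot x (u n) - L x) + (dot z (u n) - L z))); last first.
    by rewrite dotDl dotZl; ring.
  apply: (le_trans (nrmD _ _)).
  have := nrmD (a * (dot x (u n) - L x)) (dot z (u n) - L z).
  rewrite nrmM; have := nrm_ge0 a; rewrite (nrmC (L _)); nra.
- apply: (@nrm_small_le _ _ _ _ 1) => // e e0.
  have [n /= h] := filter_ex (hL z _ e0).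
  have := nrm_dot dot_norm z (u n); have := hC n; have := nrm_ge0 z.
  have := nrmBB (L z) (dot z (u n)); rewrite nrmC; nra.
exists y => z e e0; apply: filterS (hL z _ e0) => n /=; rewrite hy.
by rewrite -dotBr dotC nrm_conj.
Qed.

End UltraLimits.

(** * Words in finitely many letters and their norm limits *)

Section Words.
Set Implicit Arguments.
Unset Strict Implicit.
Local Open Scope complex_scope.
Variables (R : realType) (H : completeNormedModType R[i]).
Variables (I : finType) (L : I -> H -> H).
Hypothesis bL : forall i, bounded_operators H (L i).
Implicit Types (f p q : nat -> I).

(* The word L (f (m + k - 1)) \o ... \o L (f m). *)
Fixpoint wd f (m k : nat) (x : H) : H :=
  if k is k'.+1 then L (f (m + k')%N) (wd f m k' x) else x.

Lemma wd_add f m k l x : wd f m (k + l) x = wd f (m + k) l (wd f m k x).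
Proof. by elim: l => [|l IH]; rewrite ?addn0// addnS /= IH addnA. Qed.

Lemma wd_ext f p m n k : (forall i, (i < k)%N -> f (m + i)%N = p (n + i)%N) ->
  wd f m k =1 wd p n k.
Proof.
elim: k => [//|k IH] h x /=; rewrite h// IH// => i ik.
by apply: h; exact: ltnW.
Qed.

(** Words are windows of sequences, so concatenation glues the first [k] letters of [f] to the
    beginning of [p]. *)
Lemma wd_cat f p k l : exists q, forall x, wd q 0 (k + l) x = wd p 0 l (wd f 0 k x).
Proof.
exists (fun i => if (i < k)%N then f i else p (i - k)%N) => x.
rewrite wd_add (@wd_ext _ p (0 + k) 0 l) => [|i il]; last first.
  by rewrite !add0n ltnNge leq_addr /= addKn.
by rewrite (@wd_ext _ f 0 0 k)// => i ik; rewrite !add0n ik.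
Qed.

Lemma bounded_comp (A B : H -> H) :
  bounded_operators H A -> bounded_operators H B -> bounded_operators H (A \o B).
Proof.
move=> /bounded_opP[linA [c c0 hA]] /bounded_opP[linB [d d0 hB]].
apply/bounded_opP; split; first by move=> a x y; rewrite /= linB linA.
exists (c * d) => [|x /=]; first exact: mulr_ge0.
by apply: (le_trans (hA _)); rewrite -mulrA ler_wpM2l.
Qed.

Lemma bounded_id : bounded_operators H id.
Proof. by apply/bounded_opP; split => //; exists 1 => // x; rewrite mul1r. Qed.

Lemma bounded_scale (a : R[i]) (A : H -> H) :
  bounded_operators H A -> bounded_operators H (fun x => a *: A x).
Proof.
move=> /bounded_opP[linA [c c0 hA]]; apply/bounded_opP; split.
  by move=> b x y; rewrite linA scalerDr !scalerA mulrC.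
exists (nrm a * c) => [|x]; first by rewrite mulr_ge0 ?nrm_ge0.
by rewrite nrmZ -mulrA ler_wpM2l ?nrm_ge0.
Qed.

Lemma bounded_wd f m k : bounded_operators H (wd f m k).
Proof.
elim: k => [|k IH]; first exact: bounded_id.
exact: bounded_comp (bL _) IH.
Qed.

Lemma linear_wd f m k : linear (wd f m k).
Proof. exact: (proj1 (bounded_wd f m k)). Qed.

Lemma wd_mem (X : set (H -> H)) f m k : is_subalgebra X -> (forall i, X (L i)) ->
  (0 < k)%N -> X (wd f m k).
Proof.
move=> [_ _ hX] XL; case: k => // k _; elim: k => [|k IH]; first exact: XL.
exact: hX (XL _) IH.
Qed.

Variable dot : {dot H for Num.conj}.
Hypothesis dot_norm : inner_product_norm dot.
Variable g : nat -> H.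
Hypothesis gB : orthonormal_basis dot g.
Variable r : R.
Hypothesis r01 : 0 <= r < 1.
Hypothesis nL : forall i, near_fr dot (L i) r.

(** The distance to finite rank is submultiplicative, and the empty word is at distance at most 1
    from 0. As [r < 1], long words become almost of finite rank. *)
Lemma near_fr_wd f m k : near_fr dot (wd f m k) (r ^+ k).
Proof.
have /andP[r0 _] := r01.
elim: k => [|k IH].
  exists (fun=> 0); first exact: frank0.
  by move=> x /=; rewrite subr0 expr0 mul1r.
rewrite exprS; apply: (near_fr_comp dot_norm gB _ _ _ (nL (f (m + k)%N)) IH) => //.
  exact: (proj1 (bL _)).
exact: bounded_wd.
Qed.

Lemma expr_small (e : R) : 0 < e -> exists l : nat, r ^+ l <= e.
Proof.
move=> e0; have /andP[r0 r1] := r01.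
have h : `|r| < 1 by rewrite ger0_norm.
have := cvg_expr h => /cvgrPdist_le /(_ _ e0) [N _ hN].
exists N; have := hN N (leqnn N); rewrite sub0r normrN ger0_norm ?exprn_ge0//.
Qed.

Variables (U : set_system nat) (UU : UltraFilter U).
Variables (c : nat -> R) (f : nat -> nat -> I) (m k : nat -> nat) (M : R).
Hypothesis c_ge0 : forall n, 0 <= c n.
Hypothesis k_large : forall l, U [set n | (l <= k n)%N].
(** The bound covers all factors of the [n]-th word, with the scalar of the whole word: the middle
    [X], as well as [u X] and [X v], has to be controlled. The empty factor bounds [c n] itself. *)
Hypothesis wd_bound : forall n a b, (m n <= a)%N -> (a + b <= m n + k n)%N ->
  forall x, c n * nrm (wd (f n) a b x) <= M * nrm x.

Let W n x := (c n)%:C *: wd (f n) (m n) (k n) x.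

Lemma three_pieces (l a b : nat) : (l + l <= b)%N ->
  [/\ (a + l + (b - l - l) <= a + b)%N, (a + (l + (b - l - l)) <= a + b)%N,
      (a + l + ((b - l - l) + l) <= a + b)%N & (l + (b - l - l) + l)%N = b].
Proof. by clear => h; split; lia. Qed.

(* Writing a long word as [u X v] with [u] and [v] of fixed length, the letters
   of [u] and [v] are constant on a set of the ultrafilter, while [u] and [v]
   are close to finite rank operators. *)
Lemma ucauchy_wd : ucauchy U W.
Proof.
move=> e e0; have /andP[r0 r1] := r01.
(* Replacing [u] by [F] costs at most [d |M|], and replacing [v] by [G] at most [2 d |M|]. The total
   must not exceed [e / 3], as two words are compared through [F X G]. *)
pose d := Num.min 1 (e / (9 * (`|M| + 1))).
have M1 : 0 < `|M| + 1 by rewrite ltr_wpDl.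
have d0 : 0 < d by rewrite lt_min ltr01 divr_gt0// mulr_gt0.
have d1 : d <= 1 by rewrite ge_min lexx.
have dM : d * (9 * (`|M| + 1)) <= e.
  by rewrite -ler_pdivlMr ?mulr_gt0// ge_min lexx orbT.
have [l hl] := expr_small d0.
have [p hp] := ultra_pick_seq UU (fun n i => f n (m n + i)%N).
have [q hq] := ultra_pick_seq UU (fun n i => f n (m n + l + (k n - l - l) + i)%N).
pose v := wd p 0 l; pose u := wd q 0 l.
have [F fF hF] := near_fr_le hl (near_fr_wd q 0 l).
have [G fG hG] := near_fr_le hl (near_fr_wd p 0 l).
have [linF _] := frank_bounded dot_norm fF.
pose X n x := (c n)%:C *: wd (f n) (m n + l) (k n - l - l) x.
have linX n : linear (X n) by exact: (proj1 (bounded_scale _ (bounded_wd _ _ _))).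
have good : U [set n | [/\ (l + l <= k n)%N,
    forall i, (i < l)%N -> f n (m n + i)%N = p i &
    forall i, (i < l)%N -> f n (m n + l + (k n - l - l) + i)%N = q i]].
  by apply: filterS3 (k_large (l + l)) (hp l) (hq l) => n /=.
have nX n : (l + l <= k n)%N -> forall x, nrm (X n x) <= M * nrm x.
  move=> kn x; have [h1 _ _ _] := three_pieces (m n) kn.
  by rewrite nrmZR//; apply: wd_bound => //; exact: leq_addr.
have [S0 US0 hS0] : exists2 S, U S & forall i j, S i -> S j -> forall x,
    nrm (F (X i (G x)) - F (X j (G x))) <= e / 3 * nrm x.
  apply: (@ucauchy_frank _ UU _ _ _ dot_norm X F G M) => //; last by rewrite divr_gt0.
  by apply: filterS good => n /= [kn _ _]; exact: nX.
exists (S0 `&` [set n | [/\ (l + l <= k n)%N,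
    forall i, (i < l)%N -> f n (m n + i)%N = p i &
    forall i, (i < l)%N -> f n (m n + l + (k n - l - l) + i)%N = q i]]).
  exact: filterI.
have main n : [/\ (l + l <= k n)%N,
    forall i, (i < l)%N -> f n (m n + i)%N = p i &
    forall i, (i < l)%N -> f n (m n + l + (k n - l - l) + i)%N = q i] ->
    forall x, nrm (W n x - F (X n (G x))) <= e / 3 * nrm x.
  move=> [kn hpn hqn] x; have [_ h2 h3 h4] := three_pieces (m n) kn.
  have vE y : wd (f n) (m n) l y = v y by apply: wd_ext => i il; rewrite add0n hpn.
  have uE y : wd (f n) (m n + l + (k n - l - l)) l y = u y.
    by apply: wd_ext => i il; rewrite add0n hqn.
  have linu : linear u by exact: linear_wd.
  have WE : W n x = u (X n (v x)).
    by rewrite /W /X (linmapZ linu) -vE -uE -!wd_add addnA h4.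
  have Xv : nrm (X n (v x)) <= M * nrm x.
    rewrite /X nrmZR// -vE -wd_add; exact: wd_bound.
  have uX y : nrm (u (X n y)) <= M * nrm y.
    rewrite /X (linmapZ linu) nrmZR// -uE -wd_add.
    by apply: wd_bound => //; exact: leq_addr.
  (* The norm of [F] depends on [d] and is out of control here; [F X] is bounded because it is close
     to [u X], a scaled factor of the word. *)
  have FX y : nrm (F (X n y)) <= (M + d * M) * nrm y.
    have := nrmBB (F (X n y)) (u (X n y)); rewrite nrmC.
    have := hF (X n y); have := uX y; have := nX _ kn y; rewrite -/u; nra.
  have -> : W n x - F (X n (G x)) =
      (u (X n (v x)) - F (X n (v x))) + F (X n (v x - G x)).
    by rewrite WE (linmapB (linX n)) (linmapB linF) addrA subrK.
  apply: (le_trans (nrmD _ _)).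
  move: {h2 h3 h4} (hF (X n (v x))) (FX (v x - G x)) (hG x) => h1 h2 h3.
  have x0 := nrm_ge0 x; have y0 := nrm_ge0 (v x - G x).
  have MM := ler_norm M.
  rewrite -/u in h1; rewrite -/v in h3.
  have z0 := nrm_ge0 (X n (v x)).
  have m0 := normr_ge0 M.
  have {}h1 : nrm (u (X n (v x)) - F (X n (v x))) <= d * (`|M| * nrm x) by nra.
  have {}h2 : nrm (F (X n (v x - G x))) <= 2 * `|M| * nrm (v x - G x).
    apply: (le_trans h2); rewrite ler_wpM2r//; nra.
  have {}h2 : nrm (F (X n (v x - G x))) <= 2 * `|M| * (d * nrm x).
    by apply: (le_trans h2); rewrite ler_wpM2l// mulr_ge0.
  have : d * `|M| * 9 <= e by nra.
  nra.
move=> i j [Si gi] [Sj gj] x.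
apply: (le_trans (nrm_dist (F (X i (G x))) _ _)).
have := nrm_dist (F (X j (G x))) (F (X i (G x))) (W j x).
have := main _ gi x; have := main _ gj x; have := hS0 _ _ Si Sj x.
rewrite (nrmC (F (X j (G x))) (W j x)); lra.
Qed.

Lemma ulim_wd : exists A, [/\ bounded_operators H A, ulim U W A &
  forall e : R, 0 < e -> near_fr dot A e].
Proof.
have bW n : bounded_operators H (W n) by exact: bounded_scale (bounded_wd _ _ _).
have [A linA hA] := ucauchy_ulim UU (fun n => proj1 (bW n)) ucauchy_wd.
(* The case of the empty factor. It keeps the scalars bounded, so [c n * r ^+ k n] becomes small and
   the limit is a norm limit of finite rank operators. *)
have cM n (x : H) : c n * nrm x <= M * nrm x.
  by have := @wd_bound n (m n) 0 (leqnn _) _ x; apply; rewrite addn0 leq_addr.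
exists A; split => //.
  apply/bounded_opP; split => //; exists `|M| => //.
  apply: (ulim_bound UU hA); apply: filterS filterT => n _ x.
  rewrite /W nrmZR//; apply: (le_trans (wd_bound (leqnn _) (leqnn _) x)).
  by rewrite ler_wpM2r ?nrm_ge0// ler_norm.
move=> e e0; have e2 : 0 < e / 2 by rewrite divr_gt0.
have M1 : 0 < `|M| + 1 by rewrite ltr_wpDl.
have [l hl] := expr_small (divr_gt0 e2 M1).
have [n [/= hn kn]] := filter_ex (filterI (hA _ e2) (k_large l)).
have [F fF hF] := near_fr_wd (f n) (m n) (k n).
exists (fun x => (c n)%:C *: F x); first exact: frankZ.
have /andP[r0 r1] := r01.
move=> x; apply: (le_trans (nrm_dist (W n x) _ _)).
have h1 := hn x; rewrite nrmC in h1.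
have -> : W n x - (c n)%:C *: F x = (c n)%:C *: (wd (f n) (m n) (k n) x - F x).
  by rewrite scalerBr.
rewrite nrmZR//.
have : c n * nrm (wd (f n) (m n) (k n) x - F x) <= e / 2 * nrm x.
  apply: le_trans (_ : c n * ((e / 2 / (`|M| + 1)) * nrm x) <= _).
    rewrite ler_wpM2l//; apply: (le_trans (hF x)); rewrite ler_wpM2r ?nrm_ge0//.
    by apply: le_trans hl; rewrite ler_wiXn2l// ltW.
  have hq : c n * nrm x / (`|M| + 1) <= nrm x.
    rewrite ler_pdivrMr//; apply: (le_trans (cM n x)).
    by have := ler_norm M; have := nrm_ge0 x; nra.
  rewrite (_ : _ * _ = e / 2 * (c n * nrm x / (`|M| + 1))); last by ring.
  by rewrite ler_wpM2l// ltW.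
lra.
Qed.

End Words.

(** * The norm closure of an algebra; idempotents and minimal rank *)

Section NormClosure.
Set Implicit Arguments.
Unset Strict Implicit.
Local Open Scope complex_scope.
Variables (R : realType) (H : completeNormedModType R[i]).
Implicit Types (x y z : H) (A B F : H -> H) (X : set (H -> H)).

(** Uniform closure phrased by bounds on vectors; the supremum [opnorm] enters only in
    [nclosure_uniform]. *)
Definition nclosure X : set (H -> H) :=
  [set A | bounded_operators H A /\ forall e : R, 0 < e ->
     exists2 B, X B & forall x, nrm (A x - B x) <= e * nrm x].

Lemma nclosure_closed X A : bounded_operators H A ->
  (forall e : R, 0 < e ->
     exists2 B, nclosure X B & forall x, nrm (A x - B x) <= e * nrm x) ->
  nclosure X A.
Proof.
move=> bA h; split => // e e0; have e2 : 0 < e / 2 by rewrite divr_gt0.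
have [B [_ hB] AB] := h _ e2; have [C XC BC] := hB _ e2.
exists C => // x; apply: (le_trans (nrm_dist (B x) _ _)).
have := AB x; have := BC x; lra.
Qed.

Lemma bounded_add A B : bounded_operators H A -> bounded_operators H B ->
  bounded_operators H (fun x => A x + B x).
Proof.
move=> /bounded_opP[linA [c c0 hA]] /bounded_opP[linB [d d0 hB]].
apply/bounded_opP; split.
  by move=> a x y; rewrite linA linB scalerDr addrACA.
exists (c + d) => [|x]; first exact: addr_ge0.
apply: (le_trans (nrmD _ _)); rewrite mulrDl; exact: lerD.
Qed.

Variable X : set (H -> H).
Hypothesis algX : is_subalgebra X.

Lemma alg_bounded A : X A -> bounded_operators H A.
Proof. by case: algX => + _ _; apply. Qed.

Lemma alg_scale (a : R[i]) A : X A -> X (fun x => a *: A x).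
Proof.
case: algX => _ [X0 hX] _ XA; have := hX a A 0 XA X0.
by rewrite addr0.
Qed.

Lemma alg_add A B : X A -> X B -> X (fun x => A x + B x).
Proof.
case: algX => _ [X0 hX] _ XA XB; have := hX 1 A B XA XB.
by rewrite scale1r.
Qed.

Lemma nclosure_sub A : X A -> nclosure X A.
Proof.
move=> XA; split; first exact: alg_bounded.
by move=> e e0; exists A => // x; rewrite subrr nrm0 mulr_ge0 ?nrm_ge0// ltW.
Qed.

Lemma nclosure_bounded A : nclosure X A -> bounded_operators H A.
Proof. by case. Qed.

Lemma nclosure_scale (a : R[i]) A : nclosure X A -> nclosure X (fun x => a *: A x).
Proof.
move=> [bA hA]; split; first exact: bounded_scale.
move=> e e0; have a1 : 0 < nrm a + 1 by rewrite ltr_wpDl// nrm_ge0.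
have [B XB AB] := hA _ (divr_gt0 e0 a1).
exists (fun x => a *: B x) => [|x]; first exact: alg_scale.
rewrite -scalerBr nrmZ; apply: (@le_trans _ _ ((nrm a + 1) * (e / (nrm a + 1) * nrm x))).
  by apply: ler_pM; [exact: nrm_ge0|exact: nrm_ge0|lra|exact: AB].
by rewrite mulrA mulrCA divff ?gt_eqF// mulr1.
Qed.

Lemma nclosure_add A B : nclosure X A -> nclosure X B ->
  nclosure X (fun x => A x + B x).
Proof.
move=> [bA hA] [bB hB]; split; first exact: bounded_add.
move=> e e0; have e2 : 0 < e / 2 by rewrite divr_gt0.
have [A' XA AA'] := hA _ e2; have [B' XB BB'] := hB _ e2.
exists (fun x => A' x + B' x) => [|x]; first exact: alg_add.
rewrite opprD addrACA; apply: (le_trans (nrmD _ _)).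
have := AA' x; have := BB' x; lra.
Qed.

Lemma nclosure_comp A B : nclosure X A -> nclosure X B -> nclosure X (A \o B).
Proof.
move=> [bA hA] [bB hB]; split; first exact: bounded_comp.
have /bounded_opP[linA [c c0 cA]] := bA; have /bounded_opP[linB [d d0 dB]] := bB.
(* With [|A| <= c] and [|B| <= d], the error is at most [q d + (c + 1) q], because [A'] has norm at
   most [c + q <= c + 1]. *)
move=> e e0; pose q := Num.min 1 (e / (c + d + 1)).
have cd : 0 < c + d + 1 by rewrite ltr_wpDl// addr_ge0.
have q0 : 0 < q by rewrite lt_min ltr01 divr_gt0.
have q1 : q <= 1 by rewrite ge_min lexx.
have qe : q * (c + d + 1) <= e by rewrite -ler_pdivlMr// ge_min lexx orbT.
have [A' XA AA'] := hA _ q0; have [B' XB BB'] := hB _ q0.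
have [linA' _] := alg_bounded XA.
exists (A' \o B') => [|x]; first by case: algX => _ _; apply.
have -> : (A \o B) x - (A' \o B') x = (A (B x) - A' (B x)) + A' (B x - B' x).
  by rewrite /= (linmapB linA') addrA subrK.
apply: (le_trans (nrmD _ _)).
have h1 := AA' (B x); have h2 := dB x; have h3 := BB' x.
have h4 : nrm (A' (B x - B' x)) <= (c + 1) * nrm (B x - B' x).
  have := nrmBB (A' (B x - B' x)) (A (B x - B' x)); rewrite nrmC.
  have := AA' (B x - B' x); have := cA (B x - B' x).
  have := nrm_ge0 (B x - B' x); nra.
have x0 := nrm_ge0 x.
have {}h1 : nrm (A (B x) - A' (B x)) <= q * (d * nrm x).
  by apply: (le_trans h1); rewrite ler_wpM2l// ltW.
have {}h4 : nrm (A' (B x - B' x)) <= (c + 1) * (q * nrm x).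
  by apply: (le_trans h4); rewrite ler_wpM2l// addr_ge0.
have : q * (c + d + 1) * nrm x <= e * nrm x by rewrite ler_wpM2r.
nra.
Qed.

Variable dot : {dot H for Num.conj}.
Hypothesis dot_norm : inner_product_norm dot.
Variable g : nat -> H.
Hypothesis gB : orthonormal_basis dot g.

(* [P - F = E] with [|E| <= 1/2], so [(1 - E) P = F P]; the solutions of
   [l = b + E l] turn this into a finite rank formula for [P]. *)
Lemma idempotent_frank (P : H -> H) : bounded_operators H P ->
  (forall x, P (P x) = P x) -> near_fr dot P (1 / 2) -> frank dot P.
Proof.
move=> bP PP [F fF hF].
have [linP _] := bP; have [linF _] := frank_bounded dot_norm fF.
have [E [linE hE PE]] : exists E, [/\ linear E,
    forall x, nrm (E x) <= 1 / 2 * nrm x & forall x, P x = F x + E x].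
  exists (fun x => P x - F x); split => // [a x y|x]; last by rewrite addrC subrK.
  by rewrite linP linF opprD addrACA scalerBr.
have /choice[l hl] (b : H) : exists l, l = b + E l.
  (* Partial sums of the Neumann series for the inverse of [1 - E] applied to [b]. *)
  pose u n := iter n (fun l => b + E l) 0.
  have uS n : u n.+1 = b + E (u n) by [].
  have ub n : nrm (u n) <= 2 * nrm b.
    elim: n => [|n IH]; first by rewrite /u /= nrm0 mulr_ge0 ?nrm_ge0.
    rewrite uS; apply: (le_trans (nrmD _ _)).
    have := hE (u n); lra.
  have ud n m : nrm (u (n + m)%N - u n) <= (1 / 2) ^+ n * (2 * nrm b).
    elim: n => [|n IH]; first by rewrite expr0 mul1r add0n [u 0%N]/u /= subr0.
    rewrite addSn !uS opprD addrACA subrr add0r -(linmapB linE).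
    by apply: (le_trans (hE _)); rewrite exprS -[X in _ <= X]mulrA; apply: ler_wpM2l; first lra.
  have half01 : 0 <= (1 / 2 : R) < 1 by apply/andP; split; lra.
  have [|l hl] := @nrm_cauchy_lim _ H \oo _ u.
    move=> e e0; have b1 : 0 < 4 * nrm b + 1 by rewrite ltr_wpDl// mulr_ge0 ?nrm_ge0.
    have [N hN] := expr_small half01 (divr_gt0 e0 b1).
    exists [set n | (N <= n)%N]; first by exists N.
    move=> i j /= Ni Nj; apply: (le_trans (nrm_dist (u N) _ _)).
    have := ud N (i - N)%N; have := ud N (j - N)%N; rewrite !subnKC// (nrmC (u N)).
    have : (1 / 2) ^+ N * (4 * nrm b + 1) <= e by rewrite -ler_pdivlMr.
    have : 0 <= (1 / 2 : R) ^+ N by rewrite exprn_ge0//; lra.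
    nra.
  exists l; apply/eqP; rewrite -subr_eq0; apply/eqP.
  apply: (@nrm_small_eq0 _ _ _ 2) => e e0.
  have [N _ hN] := hl _ e0; have h1 : nrm (u N - l) <= e := hN N (leqnn N).
  have h2 : nrm (b + E (u N) - l) <= e := hN N.+1 (leqnSn N).
  have -> : l - (b + E l) = (l - (b + E (u N))) + E (u N - l).
    rewrite (linmapB linE) !opprD !addrA. by rewrite subrK.
  apply: (le_trans (nrmD _ _)); rewrite nrmC.
  have := hE (u N - l); lra.
have [s hs] := fF.
(* At [x], the right-hand side [S] solves [S = F (P x) + E S]. Idempotence makes [P x] another
   solution, and the contraction [E] allows only one. *)
suff -> : P = (fun y => \sum_(p <- s) dot y p.1 *: l p.2) \o P.
  apply: (frank_compr dot_norm gB bP).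
  by exists [seq (p.1, l p.2) | p <- s] => x; rewrite big_map.
apply/funext => x /=; set S := \sum_(p <- s) _.
have SE : S = F (P x) + E S.
  rewrite /S (linmap_sum linE) hs -big_split/=; apply: eq_bigr => p _.
  by rewrite {1}hl scalerDr (linmapZ linE).
have PxE : P x = F (P x) + E (P x) by rewrite -PE PP.
have : P x - S = E (P x - S).
  by rewrite (linmapB linE) {1}PxE {1}SE opprD addrACA subrr add0r.
move=> h; apply/eqP; rewrite -subr_eq0; apply/eqP/nrm_eq0.
have := hE (P x - S); rewrite -h; have := nrm_ge0 (P x - S); lra.
Qed.

(** Rank at most [r]. The coordinates are merely linear, so those produced by a matrix factorization
    need no continuity check. *)
Definition rk (r : nat) F : Prop := exists (f : 'I_r -> H -> R[i]) (b : 'I_r -> H),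
  (forall i, scalar (f i)) /\ forall x, F x = \sum_i f i x *: b i.

Lemma frank_rk F : frank dot F -> exists r, rk r F.
Proof.
move=> [s hs]; exists (size s).
exists (fun i x => dot x (nth (0, 0) s i).1), (fun i => (nth (0, 0) s i).2).
split; first by move=> i a x y; rewrite dotDl dotZl.
by move=> x; rewrite hs (big_nth (0, 0)) big_mkord.
Qed.

Lemma scalar_suml (n : nat) (f : 'I_n -> H -> R[i]) (c : 'I_n -> R[i]) :
  (forall i, scalar (f i)) -> scalar (fun x => \sum_i f i x * c i).
Proof.
move=> hf a x y; rewrite mulr_sumr -big_split/=; apply: eq_bigr => i _.
by rewrite hf mulrDl mulrA.
Qed.

(* In a nonzero [F] of minimal rank, [F A F - lambda F] has smaller rank when
   [lambda] is an eigenvalue of the matrix of [F A] on the range of [F]. *)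
Lemma minimal_rank_eigen F : nclosure X F -> F != (fun=> 0) -> frank dot F ->
  exists2 G, nclosure X G /\ G != (fun=> 0) &
    forall A, X A -> exists lam : R[i], forall x, G (A (G x)) = lam *: G x.
Proof.
move=> XF F0 /frank_rk[r0 rF].
pose Q r := `[< exists2 G, nclosure X G /\ G != (fun=> 0) & rk r G >].
have exQ : exists r, Q r by exists r0; apply/asboolP; exists F.
case: (ex_minnP exQ) => r /asboolP[G [XG G0] [f [b [linf hG]]]] rmin.
exists G => // A XA.
have r_gt0 : (0 < r)%N.
  rewrite lt0n; apply/eqP => r00; move/eqP: G0; apply; apply/funext => x.
  by rewrite hG; move: f b linf hG; rewrite r00 => *; rewrite big_ord0.
(* In row convention: if [G x] has coordinates [c] on the vectors [b], then [G (A (G x))] has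
   coordinates [c M], so [D x] below has coordinates [c N]. *)
pose M : 'M[R[i]]_r := \matrix_(l, k) f k (A (b l)).
have [lam /eigenvalueP[v vM v0]] := eigenvalue_closed M r_gt0.
pose N := M - lam%:M.
have rkN : (\rank N < r)%N.
  rewrite ltnNge; apply/negP => rN.
  have /row_freeP[B NB] : row_free N by rewrite /row_free eqn_leq rank_leq_row.
  have vN : v *m N = 0 by rewrite mulmxBr vM mul_mx_scalar subrr.
  by move/eqP: v0; apply; rewrite -[v]mulmx1 -NB mulmxA vN mul0mx.
exists lam => x; apply/eqP; rewrite -subr_eq0; apply/eqP.
pose D x := G (A (G x)) - lam *: G x.
suff D0 : D = (fun=> 0) by have := congr1 (@^~ x) D0.
apply: contrapT => /eqP D0.
suff /rmin : Q (\rank N) by rewrite leqNgt rkN.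
apply/asboolP; exists D.
  split => //.
  have -> : D = (fun x => (G \o A \o G) x + (- lam) *: G x).
    by apply/funext => y; rewrite /D /= scaleNr.
  apply: nclosure_add; last exact: nclosure_scale.
  apply: nclosure_comp => //; apply: nclosure_comp => //; exact: nclosure_sub.
have [linA _] := alg_bounded XA.
(* The factorization of [N] into [col_base] and [row_base] passes through dimension [\rank N], which
   gives that many functionals and vectors for [D]. *)
exists (fun j y => \sum_l f l y * col_base N l j).
exists (fun j => \sum_k row_base N j k *: b k).
split; first by move=> j; exact: scalar_suml.
move=> y; have fsum k : f k (A (G y)) = \sum_l f l y * M l k.
  have f0 : f k 0 = 0.
    by have := linf k (-1) 0 0; rewrite scaler0 addr0 mulN1r addNr.
  rewrite hG (linmap_sum linA).
  elim/big_rec2: _ => // l c z _ <-.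
  by rewrite (linmapZ linA) linf mxE.
have -> : D y = \sum_k (\sum_l f l y * N l k) *: b k.
  rewrite /D [G (A _)]hG [X in lam *: X]hG scaler_sumr -sumrB; apply: eq_bigr => k _.
  rewrite fsum scalerA -scalerBl; congr (_ *: _).
  rewrite [X in _ - X](_ : _ = \sum_l f l y * (lam%:M : 'M[R[i]]_r) l k).
    by rewrite -sumrB; apply: eq_bigr => l _; rewrite !mxE mulrBr.
  rewrite (bigD1 k)//= mxE eqxx mulr1n big1 ?addr0 1?mulrC// => l lk.
  by rewrite mxE (negPf lk) mulr0n mulr0.
transitivity (\sum_j \sum_k ((\sum_l f l y * col_base N l j) * row_base N j k) *: b k).
  rewrite exchange_big/=; apply: eq_bigr => k _; rewrite -scaler_suml; congr (_ *: _).
  have NE l : N l k = \sum_j col_base N l j * row_base N j k.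
    by rewrite -{1}[N]mulmx_base mxE.
  under eq_bigr do rewrite NE mulr_sumr.
  rewrite exchange_big/=; apply: eq_bigr => j _; rewrite mulr_suml.
  by apply: eq_bigr => l _; rewrite mulrA.
apply: eq_bigr => j _; rewrite scaler_sumr; apply: eq_bigr => k _.
by rewrite scalerA.
Qed.

End NormClosure.

(** * From one finite rank operator to all compact operators *)

Section Density.
Set Implicit Arguments.
Unset Strict Implicit.
Local Open Scope complex_scope.
Variables (R : realType) (H : completeNormedModType R[i]).
Implicit Types (x y z : H) (A B F : H -> H).
Variable X : set (H -> H).
Hypothesis algX : is_subalgebra X.
Variable dot : {dot H for Num.conj}.
Hypothesis dot_norm : inner_product_norm dot.
Variable g : nat -> H.
Hypothesis gB : orthonormal_basis dot g.

Definition transitive_family : Prop := forall y z (e : R), y != 0 -> 0 < e ->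
  exists2 A, X A & nrm (A y - z) < e.

Hypothesis trX : transitive_family.

Lemma dot_neq0 y : y != 0 -> dot y y != 0.
Proof.
by move=> y0; rewrite dotxx// eq_complex /= eqxx andbT sqrf_eq0 gt_eqF// nrm_gt0.
Qed.

Lemma adjoint_vector A a : bounded_operators H A ->
  exists a', forall x, dot (A x) a = dot x a'.
Proof.
move=> /bounded_opP[linA [C C0 hA]].
apply: (@riesz _ _ _ dot_norm g gB _ (C * nrm a)).
  by move=> c x y; rewrite linA dotDl dotZl.
move=> x; apply: (le_trans (nrm_dot dot_norm _ _)).
have := hA x; have := nrm_ge0 a; nra.
Qed.

Lemma rank_one_bounded a b : bounded_operators H (fun x => dot x a *: b).
Proof.
by apply: (frank_bounded dot_norm); exists [:: (a, b)] => x; rewrite big_seq1.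
Qed.

(** For [y = G x0] nonzero, [G A G = lam G] sends every [A y] into the line of [y] under [G]. The
    vectors [A y] are dense, so the whole range of [G] is that line. *)
Lemma rank_one_mem F : nclosure X F -> F != (fun=> 0) -> frank dot F ->
  exists a b, [/\ a != 0, b != 0 & nclosure X (fun x => dot x a *: b)].
Proof.
move=> XF F0 fF.
have [G [XG G0] hG] := minimal_rank_eigen algX XF F0 fF.
have /bounded_opP[linG [C C0 hC]] := nclosure_bounded XG.
have [x0 y0] : exists x0, G x0 != 0.
  apply: contrapT => /forallNP h; move/eqP: G0; apply; apply/funext => x.
  by apply/eqP; apply: contrapT => /negP; exact: h.
set y := G x0 in y0; have yy := dot_neq0 y0.
(* The projection orthogonal to [y]: a contraction that kills the line, so that membership in the
   line becomes [Q (G z) = 0], which can be proved by approximation. *)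
pose Q w := w - (dot w y / dot y y) *: y.
have QD u v : Q (u - v) = Q u - Q v.
  by rewrite /Q dotBl mulrBl scalerBl !opprD !opprK addrACA.
have Qy c : Q (c *: y) = 0 by rewrite /Q dotZl mulfK// subrr.
have nQ w : nrm (Q w) <= nrm w.
  have orth : dot ((dot w y / dot y y) *: y) (Q w) = 0.
    by rewrite dotZl [dot y (Q w)]dotC /Q dotBl dotZl divfK// subrr rmorph0 mulr0.
  apply: nrm_le_sqr; first exact: nrm_ge0.
  have -> : nrm w ^+ 2 = nrm ((dot w y / dot y y) *: y) ^+ 2 + nrm (Q w) ^+ 2.
    by rewrite -(nrm_sqD_orth dot_norm orth) addrC subrK.
  by rewrite lerDr sqr_ge0.
have line z : G z = (dot (G z) y / dot y y) *: y.
  apply/eqP; rewrite -subr_eq0 -/(Q (G z)); apply/eqP.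
  apply: (@nrm_small_eq0 _ _ _ C) => e e0.
  have [A XA hA] := trX z y0 e0.
  have [lam hlam] := hG A XA.
  have -> : Q (G z) = Q (G (z - A y)).
    by rewrite (linmapB linG) QD /y hlam Qy subr0.
  apply: (le_trans (nQ _)); apply: (le_trans (hC _)).
  by rewrite mulrC ler_wpM2r// nrmC ltW.
have [a ha] := adjoint_vector y (nclosure_bounded XG).
exists a, ((dot y y)^-1 *: y); split.
- by apply: contra_neq yy => a0; rewrite {1}/y ha a0 dot0r.
- by rewrite scaler_eq0 negb_or invr_eq0 yy y0.
- rewrite (_ : (fun x => _) = G)//; apply/funext => x.
  by rewrite -ha scalerA -line.
Qed.

(** Composing on the left moves [b0] close to any [b], so [a0] lies in [Z]; composing on the right
    puts the adjoint images of [a0] in [Z]. A nonzero [h] orthogonal to the closed subspace [Z]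
    would give [dot (A h) a0 = 0] for all [A] in [X], although some [A h] is closer to [a0] than 0
    is. *)
Lemma rank_one_all : (exists2 F, nclosure X F & frank dot F /\ F != (fun=> 0)) ->
  forall a b, nclosure X (fun x => dot x a *: b).
Proof.
move=> [F XF [fF F0]].
have [a0 [b0 [a00 b00 h0]]] := rank_one_mem XF F0 fF.
pose Z := [set a | forall b, nclosure X (fun x => dot x a *: b)].
have Za0 : Z a0.
  move=> b; apply: nclosure_closed; first exact: rank_one_bounded.
  move=> e e0; have a1 : 0 < nrm a0 by exact: nrm_gt0.
  have [A XA hA] := trX b b00 (divr_gt0 e0 a1).
  have [linA _] := alg_bounded algX XA.
  exists (A \o (fun x => dot x a0 *: b0)).
    by apply: nclosure_comp => //; exact: nclosure_sub.
  move=> x /=; rewrite (linmapZ linA) -scalerBr nrmZ nrmC.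
  apply: le_trans (_ : nrm x * nrm a0 * (e / nrm a0) <= _).
    by apply: ler_pM; [exact: nrm_ge0|exact: nrm_ge0|exact: nrm_dot|exact: ltW].
  by rewrite mulrAC -mulrA mulrC divfK ?gt_eqF.
have sZ : is_subspace Z.
  split.
    move=> b; rewrite (_ : (fun x => _) = (fun x => 0 *: (dot x a0 *: b0))).
      exact: nclosure_scale.
    by apply/funext => x; rewrite dot0r !scale0r.
  move=> c u v Zu Zv b.
  rewrite (_ : (fun x => _) =
    (fun x => dot x u *: (Num.conj c *: b) + dot x v *: b)).
    by apply: nclosure_add; [exact: algX|exact: Zu|exact: Zv].
  by apply/funext => x; rewrite dotDr dotZr scalerDl scalerA [_ * dot _ _]mulrC.
have cZ a : closure Z a -> Z a.
  move=> /closure_nrm ca b; apply: nclosure_closed; first exact: rank_one_bounded.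
  move=> e e0; have b1 : 0 < nrm b + 1 by rewrite ltr_wpDl// nrm_ge0.
  have [a' Za' aa'] := ca _ (divr_gt0 e0 b1).
  exists (fun x => dot x a' *: b); first exact: Za'.
  move=> x; rewrite -scalerBl -dotBr nrmZ.
  have h1 := nrm_dot dot_norm x (a - a').
  have h2 : nrm (a - a') * (nrm b + 1) <= e by rewrite -ler_pdivlMr// ltW.
  have := nrm_ge0 b; have := nrm_ge0 x; have := nrm_ge0 (a - a').
  move: h1 h2; set p := nrm (dot _ _); set q := nrm (a - a'); set s := nrm b.
  set t := nrm x => h1 h2 q0 t0 s0.
  apply: (@le_trans _ _ (t * q * s)); first by rewrite ler_wpM2r.
  rewrite -mulrA [e * _]mulrC ler_wpM2l//; nra.
move=> a; apply: cZ.
apply: (orthogonal_trivial_dense dot_norm sZ) => h hZ.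
apply/eqP; apply: contrapT => /negP h00.
have a1 : 0 < nrm a0 by exact: nrm_gt0.
have [A XA hA] := trX a0 h00 a1.
have [a' ha'] := adjoint_vector a0 (alg_bounded algX XA).
have Za' : Z a'.
  move=> b; rewrite (_ : (fun x => _) = (fun x => dot x a0 *: b) \o A).
    by apply: (nclosure_comp algX); [exact: Za0|exact: nclosure_sub].
  by apply/funext => x /=; rewrite ha'.
have := hZ _ Za'; rewrite -ha' => Aha.
have : dot (A h - a0) a0 = - dot a0 a0 by rewrite dotBl Aha sub0r.
move=> /(congr1 (@nrm R _)); rewrite nrmN dotxx// nrm_real ger0_norm ?sqr_ge0//.
by have := nrm_dot dot_norm (A h - a0) a0; nra.
Qed.

Hypothesis exF : exists2 F, nclosure X F & frank dot F /\ F != (fun=> 0).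

Lemma frank_mem F : frank dot F -> nclosure X F.
Proof.
move=> [s hs].
have -> : F = (fun x => \sum_(p <- s) dot x p.1 *: p.2) by apply/funext.
elim: s {hs} => [|p s IH].
  rewrite (_ : (fun x => _) = (fun x => dot x 0 *: 0)).
    exact: rank_one_all.
  by apply/funext => x; rewrite big_nil scaler0.
rewrite (_ : (fun x => _) =
  (fun x => dot x p.1 *: p.2 + \sum_(q <- s) dot x q.1 *: q.2)).
  by apply: nclosure_add => //; exact: rank_one_all.
by apply/funext => x; rewrite big_cons.
Qed.

Lemma frank_oproj n : frank dot (fun x => oproj dot g x n).
Proof.
exists [seq (g j, g j) | j <- iota 0 n] => x.
rewrite big_map -[n in iota 0 n]subn0 -/(index_iota 0 n) big_mkord.
by [].
Qed.

Lemma linear_oproj n : linear (fun x => oproj dot g x n).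
Proof. by move=> a x y; rewrite oprojD. Qed.

(** Otherwise some [u n] in the unit ball has [A (u n)] at distance more than [e] from its [n]-th
    projection. Near a cluster point [p] of these images, late projections err by at most [e/3] on
    [p] and [e/3] on the difference. *)
Lemma compact_oproj A : compact_operators H A -> forall e : R, 0 < e ->
  exists n, forall x, nrm (A x - oproj dot g (A x) n) <= e * nrm x.
Proof.
move=> [bA cA] e e0; have /bounded_opP[linA _] := bA.
suff [n hn] : exists n, forall x, `|x| <= 1 -> nrm (A x - oproj dot g (A x) n) <= e.
  exists n => x; have [->|x0] := eqVneq x 0.
    rewrite (linmap0 linA) (linmap0 (linear_oproj n)) subrr !nrm0 mulr0//.
  have nx := nrm_gt0 x0.
  have := hn ((nrm x)^-1%:C *: x).
  rewrite (linmapZ linA) (linmapZ (linear_oproj n)) -scalerBr normE.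
  rewrite !nrmZR ?invr_ge0 ?nrm_ge0// mulVf ?gt_eqF// lexx => /(_ isT).
  by rewrite ler_pdivrMl// mulrC.
apply: contrapT => /forallNP h.
have /choice[u hu] n : exists x, `|x| <= 1 /\ e < nrm (A x - oproj dot g (A x) n).
  have /existsNP[x /not_implyP[x1 /negP]] := h n.
  by rewrite -ltNge => hx; exists x.
pose G : set_system H := (fun n => A (u n)) @ \oo.
have FG : ProperFilter G by exact: fmap_proper_filter.
have GA : G (closure [set A x | x in [set x : H | `|x| <= 1]]).
  exists 0%N => // n _ /=; apply: subset_closure.
  by exists (u n) => //; exact: (hu n).1.
have [p [_ clp]] := cA G FG GA.
have e3 : 0 < e / 3 by rewrite divr_gt0.
have [N hN] := oproj_cvg dot_norm gB p e3.
have GN : G (range (fun n => A (u (N + n)%N))).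
  exists N => // n /= Nn; exists (n - N)%N => //; by rewrite subnKC.
have pN : nbhs p [set y | nrm (p - y) < e / 3] by apply/nbhs_nrm; exists (e / 3).
have [_ [[n _ <-] /= hp]] := clp _ _ GN pN.
have := (hu (N + n)%N).2; apply/negP; rewrite -leNgt.
set w := A _ in hp *.
have -> : w - oproj dot g w (N + n) =
    (p - oproj dot g p (N + n)) - ((p - w) - oproj dot g (p - w) (N + n)).
  by rewrite (linmapB (linear_oproj _)) !opprB !addrA subrK addrC -!addrA addKr addrC.
apply: (le_trans (nrmB _ _)).
have := hN (N + n)%N (leq_addr _ _).
have := nrm_oproj_compl dot_norm gB (p - w) (N + n); lra.
Qed.

Lemma compact_mem A : compact_operators H A -> nclosure X A.
Proof.
move=> cA; have [bA _] := cA; apply: nclosure_closed => // e e0.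
have [n hn] := compact_oproj cA e0.
exists ((fun x => oproj dot g x n) \o A); last exact: hn.
by apply: frank_mem; apply: (frank_compr dot_norm gB bA); exact: frank_oproj.
Qed.

(** Projections converge pointwise to the identity, so on the finite list [A] is close to [A] after
    a projection. That operator has finite rank, hence is a norm limit of elements of [X]. *)
Lemma strong_approx A (s : seq H) (e : R) : bounded_operators H A -> 0 < e ->
  exists2 B, X B & forall x, x \in s -> nrm (A x - B x) < e.
Proof.
move=> bA e0; have /bounded_opP[linA [C C0 hC]] := bA.
have [d d0 hd] : exists2 d : R, 0 < d & forall x, x \in s -> d * nrm x < e / 2.
  elim: s => [|y s [d d0 IH]]; first by exists 1.
  have y1 : 0 < nrm y + 1 by rewrite ltr_wpDl// nrm_ge0.
  have e2 : 0 < e / 2 by rewrite divr_gt0.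
  exists (Num.min d (e / 2 / (nrm y + 1))); first by rewrite lt_min d0 divr_gt0.
  move=> x; rewrite inE => /orP[/eqP ->|xs].
    apply: le_lt_trans (_ : e / 2 / (nrm y + 1) * nrm y < _).
      by rewrite ler_wpM2r ?nrm_ge0// ge_min lexx orbT.
    by rewrite mulrAC ltr_pdivrMr// ltr_pM2l// ltrDl.
  apply: le_lt_trans (IH x xs).
  by rewrite ler_wpM2r ?nrm_ge0// ge_min lexx.
have [n hn] : exists n, forall x, x \in s -> nrm (A x - A (oproj dot g x n)) < e / 2.
  have [N hN] : exists N, forall n, (N <= n)%N -> forall x, x \in s ->
      nrm (A x - A (oproj dot g x n)) < e / 2.
    elim: s {hd} => [|y s [N IH]]; first by exists 0%N.
    have C1 : 0 < 2 * (C + 1) by rewrite mulr_gt0// ltr_wpDl.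
    have [N' hN'] := oproj_cvg dot_norm gB y (divr_gt0 e0 C1).
    exists (maxn N N') => n; rewrite geq_max => /andP[n1 n2] x.
    rewrite inE => /orP[/eqP ->|xs]; last exact: IH.
    rewrite -(linmapB linA); apply: (le_lt_trans (hC _)).
    have h := hN' n n2.
    have : nrm (y - oproj dot g y n) * (2 * (C + 1)) <= e by rewrite -ler_pdivlMr.
    have := nrm_ge0 (y - oproj dot g y n); nra.
  by exists N; exact: hN.
have fA : frank dot (A \o (fun x => oproj dot g x n)).
  by apply: frank_compl => //; exact: frank_oproj.
have [_ /(_ _ d0)[B XB hB]] := frank_mem fA.
exists B => // x xs; apply: (le_lt_trans (nrm_dist (A (oproj dot g x n)) _ _)).
have := hn x xs; have := hd x xs; have := hB x; rewrite /=; lra.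
Qed.

End Density.

Section PowerEstimates.
Variable R : realType.

(** For a fixed exponent, a rate slightly above 1 costs at most a constant factor; every use takes
    [c = 2]. *)
Lemma expr_close1 (k : nat) (c : R) : 1 < c ->
  exists2 d : R, 0 < d & (1 + d) ^+ k <= c.
Proof.
elim: k c => [|k IH] c c1; first by exists 1 => //; rewrite expr0 ltW.
have [|d d0 hd] := IH ((1 + c) / 2); first lra.
have c'0 : 0 < (1 + c) / 2 by lra.
pose d' := Num.min d ((c - (1 + c) / 2) / ((1 + c) / 2)).
have d'0 : 0 < d' by rewrite lt_min d0 divr_gt0//; lra.
have d'd : d' <= d by rewrite ge_min lexx.
have hd' : d' * ((1 + c) / 2) <= c - (1 + c) / 2.
  by rewrite -ler_pdivlMr// ge_min lexx orbT.
exists d' => //; rewrite exprS.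
have : (1 + d') ^+ k <= (1 + c) / 2.
  by apply: le_trans hd; apply: lerXn2r; rewrite ?nnegrE; lra.
nra.
Qed.

End PowerEstimates.

(** * An idempotent limit of bounded words *)

Section Idempotent.
Set Implicit Arguments.
Unset Strict Implicit.
Local Open Scope complex_scope.
Variables (R : realType) (H : completeNormedModType R[i]).
Variables (I : finType) (L : I -> H -> H).
Hypothesis bL : forall i, bounded_operators H (L i).
Variable X : set (H -> H).
Hypothesis algX : is_subalgebra X.
Hypothesis XL : forall i, X (L i).
Variable dot : {dot H for Num.conj}.
Hypothesis dot_norm : inner_product_norm dot.
Variable g : nat -> H.
Hypothesis gB : orthonormal_basis dot g.
Variable r : R.
Hypothesis r01 : 0 <= r < 1.
Hypothesis nL : forall i, near_fr dot (L i) r.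
Variables (U : set_system nat) (UU : UltraFilter U).
Hypothesis ooU : \oo `<=` U.
Variable M : R.
Hypothesis M_gt0 : 0 < M.
Hypothesis word_bound : forall f m k x, nrm (wd L f m k x) <= M * nrm x.
Variable d : R.
Hypothesis d_gt0 : 0 < d.
Hypothesis long_words : forall k, exists f, exists2 x, x != 0 &
  d * nrm x <= nrm (wd L f 0 k x).

Lemma ultra_ge l : U [set n | (l <= n)%N].
Proof. by apply: ooU; exists l. Qed.

(** König's lemma along [U]: each prefix of [s] is a prefix of some long word that is not small, and
    the rest of that word has norm at most [M], so the prefix has norm at least [d / M]. *)
Lemma infinite_word : exists s : nat -> I, forall l, exists2 x, x != 0 &
  d * nrm x <= M * nrm (wd L s 0 l x).
Proof.
have [F hF] := choice long_words.
have [s hs] := ultra_pick_seq UU F.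
exists s => l.
have [n [/= h1 h2]] := filter_ex (filterI (hs l) (ultra_ge l)).
have [x x0 hx] := hF n; exists x => //; apply: (le_trans hx).
have -> : wd L (F n) 0 n x = wd L (F n) l (n - l) (wd L s 0 l x).
  by rewrite -(@wd_ext _ _ _ L (F n) s 0 0 l)// -[in RHS](add0n l) -wd_add subnKC.
exact: word_bound.
Qed.

Lemma ulim_unit_wd (s : nat -> I) (m k : nat -> nat) :
  (forall l, U [set n | (l <= k n)%N]) ->
  exists A, [/\ bounded_operators H A, ulim U (fun n => wd L s (m n) (k n)) A &
    forall e : R, 0 < e -> near_fr dot A e].
Proof.
move=> hk.
have [n a b _ _ x|A [bA hA nA]] := @ulim_wd _ _ _ _ bL _ dot_norm _ gB _ r01 nL
  _ UU (fun=> 1) (fun=> s) m k M (fun=> ler01) hk.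
  by rewrite mul1r.
exists A; split => // e e0; apply: filterS (hA e e0) => n hn x.
by have := hn x; rewrite scale1r.
Qed.

(* Along an infinite word, [E m] is the limit of the factors [w(m, n)] as
   [n -> U] and [E'] that of [E m] as [m -> U]; the relations
   [w(m, n) w(l, m) = w(l, n)] pass to [E m w(l, m) = E l], then to
   [E' E l = E l], and finally to [E' E' = E']. *)
Lemma idempotent_in_closure : exists P, [/\ nclosure X P, forall x, P (P x) = P x,
  (forall e : R, 0 < e -> near_fr dot P e) & P != (fun=> 0)].
Proof.
have [s hs] := infinite_word.
have large_sub m l : U [set n | (l <= n - m)%N].
  by apply: filterS (ultra_ge (l + m)) => n /= ln;
    rewrite leq_subRL ?(leq_trans _ ln) ?leq_addl// addnC.
have /choice[E hE] m := @ulim_unit_wd s (fun=> m) (fun n => (n - m)%N) (large_sub m).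
have limE m (e : R) : 0 < e ->
    U [set n | forall x, nrm (wd L s m (n - m) x - E m x) <= e * nrm x].
  by case: (hE m) => _ + _; apply.
(* Each [E m] is replaced by a nearby finite factor: limits are available for words only, and this
   puts [E'] in the norm closure of [X]. The lengths exceed [m], so they tend to infinity. *)
have /choice[k hk] m : exists k, (m < k)%N /\
    forall x, nrm (wd L s m k x - E m x) <= m.+1%:R^-1 * nrm x.
  have m0 : 0 < m.+1%:R^-1 :> R by rewrite invr_gt0.
  have [n [/= h1 h2]] := filter_ex (filterI (limE m _ m0) (ultra_ge (m.+1 + m))).
  by exists (n - m)%N; split => //; rewrite ltn_subRL.
have [|E' [bE' limE' nE']] := @ulim_unit_wd s id k.
  move=> l; apply: filterS (ultra_ge l) => n /= ln.
  by apply: (leq_trans ln); exact: ltnW (hk n).1.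
have /bounded_opP[linE' [C C0 hC]] := bE'.
have EE' (e : R) : 0 < e -> U [set m | forall x, nrm (E m x - E' x) <= e * nrm x].
  move=> e0; have e2 : 0 < e / 2 by rewrite divr_gt0.
  apply: filterS2 (limE' _ e2) (ultra_ge (Num.trunc (e / 2)^-1)) => m /= h1 h2 x.
  apply: (le_trans (nrm_dist (wd L s m (k m) x) _ _)); rewrite nrmC.
  have h3 : m.+1%:R^-1 <= e / 2.
    rewrite -[e / 2]invrK lef_pV2 ?posrE ?ltr0n ?invr_gt0//.
    by apply: ltW; apply: lt_le_trans (truncnS_gt _) _; rewrite ler_nat ltnS.
  have h4 := (hk m).2 x; have h5 : nrm (wd L s m (k m) x - E' x) <= e / 2 * nrm x := h1 x.
  have x0 := nrm_ge0 x.
  have {}h4 := le_trans h4 (ler_wpM2r x0 h3).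
  rewrite [leRHS](_ : _ = e / 2 * nrm x + e / 2 * nrm x); first exact: lerD.
  by rewrite -mulrDl -splitr.
have Ew l m x : (l <= m)%N -> E m (wd L s l (m - l) x) = E l x.
  move=> lm; apply/eqP; rewrite -subr_eq0; apply/eqP.
  apply: (@nrm_small_eq0 _ _ _ ((M + 1) * nrm x)) => e e0.
  have [n [[/= h1 h2] h3]] :=
    filter_ex (filterI (filterI (limE m _ e0) (limE l _ e0)) (ultra_ge m)).
  have wE : wd L s l (n - l) x = wd L s m (n - m) (wd L s l (m - l) x).
    have -> : (n - l = (m - l) + (n - m))%N by rewrite addnC addnBA// subnK.
    by rewrite wd_add subnKC.
  apply: (le_trans (nrm_dist (wd L s l (n - l) x) _ _)).
  have := h2 x; have := h1 (wd L s l (m - l) x); rewrite nrmC -wE.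
  have : e * nrm (wd L s l (m - l) x) <= e * (M * nrm x) by rewrite ler_pM2l.
  lra.
have E'E l x : E' (E l x) = E l x.
  apply/eqP; rewrite -subr_eq0; apply/eqP.
  apply: (@nrm_small_eq0 _ _ _ ((C + M) * nrm x)) => e e0.
  have [m [[/= h1 h2] h3]] :=
    filter_ex (filterI (filterI (EE' _ e0) (limE l _ e0)) (ultra_ge l)).
  have -> : E' (E l x) - E l x = E' (E l x - wd L s l (m - l) x) +
      (E' (wd L s l (m - l) x) - E m (wd L s l (m - l) x)).
    by rewrite Ew// (linmapB linE') addrA subrK.
  apply: (le_trans (nrmD _ _)).
  have h4 : nrm (E l x - wd L s l (m - l) x) <= e * nrm x by rewrite nrmC; exact: h2.
  have := le_trans (hC _) (ler_wpM2l C0 h4).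
  have := h1 (wd L s l (m - l) x); rewrite nrmC.
  have := ler_wpM2l (ltW e0) (word_bound s l (m - l) x); lra.
have E'E' x : E' (E' x) = E' x.
  apply/eqP; rewrite -subr_eq0; apply/eqP.
  apply: (@nrm_small_eq0 _ _ _ ((C + 1) * nrm x)) => e e0.
  have [m /= h1] := filter_ex (EE' _ e0).
  have -> : E' (E' x) - E' x = E' (E' x - E m x) + (E m x - E' x).
    by rewrite (linmapB linE') E'E addrA subrK.
  apply: (le_trans (nrmD _ _)); have h2 := h1 x.
  have h3 : nrm (E' x - E m x) <= e * nrm x by rewrite nrmC.
  have := le_trans (hC _) (ler_wpM2l C0 h3); lra.
exists E'; split => //.
  split => // e e0.
  have [n /= hn] := filter_ex (limE' _ e0).
  exists (wd L s n (k n)) => [|x]; last by rewrite nrmC; exact: hn.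
  by apply: wd_mem => //; exact: leq_ltn_trans (hk n).1.
apply/eqP => E'0.
have E0 x : E 0%N x = 0 by rewrite -E'E E'0.
(* If [E'] vanished, [E 0] would be 0, so some prefix of [s] would have norm at most half of the
   lower bound [d / M]. *)
have e0 : 0 < d / (2 * M) by rewrite divr_gt0// mulr_gt0.
have [n /= hn] := filter_ex (limE 0%N _ e0).
have [x x0 hx] := hs n; have := hn x; rewrite E0 subr0 subn0 => h.
have : M * nrm (wd L s 0 n x) <= d / 2 * nrm x.
  rewrite (_ : d / 2 = M * (d / (2 * M))); first by rewrite -mulrA ler_pM2l.
  by field; rewrite gt_eqF.
have := mulr_gt0 d_gt0 (nrm_gt0 x0); lra.
Qed.

End Idempotent.

(** * Rescaling the letters by the critical scalar *)

Section SpectralRadius.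
Set Implicit Arguments.
Unset Strict Implicit.
Local Open Scope complex_scope.
Variables (R : realType) (H : completeNormedModType R[i]).
Variables (I : finType) (L : I -> H -> H).
Hypothesis bL : forall i, bounded_operators H (L i).
Variable dot : {dot H for Num.conj}.
Hypothesis dot_norm : inner_product_norm dot.
Variable g : nat -> H.
Hypothesis gB : orthonormal_basis dot g.
Variable r : R.
Hypothesis r01 : 0 <= r < 1.
Hypothesis nL : forall i, near_fr dot (L i) r.
Variables (U : set_system nat) (UU : UltraFilter U).
Hypothesis ooU : \oo `<=` U.
Hypothesis dense_words : forall y z (e : R), y != 0 -> 0 < e ->
  exists (a : R[i]) f k, nrm (a *: wd L f 0 k y - z) < e.

Lemma letters_bound : exists2 b : R, 1 <= b &
  forall f m k x, nrm (wd L f m k x) <= b ^+ k * nrm x.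
Proof.
have /choice[c hc] i : exists c : R, 0 <= c /\ forall x, nrm (L i x) <= c * nrm x.
  by have /bounded_opP[_ [c c0 h]] := bL i; exists c.
exists (1 + \sum_i c i); first by rewrite lerDl sumr_ge0// => i _; exact: (hc i).1.
have ci i : c i <= 1 + \sum_i c i.
  rewrite (bigD1 i)//= addrCA lerDl addr_ge0// sumr_ge0// => j _.
  exact: (hc j).1.
move=> f m; elim=> [|k IH] x; first by rewrite expr0 mul1r.
rewrite /= exprS -mulrA; apply: (le_trans ((hc _).2 _)).
apply: ler_pM => //; [exact: (hc _).1|exact: nrm_ge0].
Qed.

(* The limit [W] of words of maximal norm [t^k |w| ~ M], rescaled by [M], would
   satisfy [W w W = 0] for every word [w], because [w' w w'] is again a word and
   [M] tends to infinity. *)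
Lemma words_not_unbounded (t0 : R) (t M : nat -> R) (f : nat -> nat -> I)
    (k : nat -> nat) :
  0 < t0 -> (forall j, t0 <= t j <= 1) -> (forall j, j.+1%:R <= M j) ->
  (forall j p m l x, t j ^+ l * nrm (wd L p m l x) <= M j * nrm x) ->
  (forall j, exists2 x, x != 0 &
     M j / 2 * nrm x <= t j ^+ k j * nrm (wd L (f j) 0 (k j) x)) -> False.
Proof.
move=> t00 ht hM hbd hlong.
have M0 j : 0 < M j by apply: lt_le_trans (hM j); rewrite ltr0n.
have tp j : 0 < t j by have /andP[h _] := ht j; exact: lt_le_trans h.
have t1 j : t j <= 1 by have /andP[] := ht j.
have oo_ge l : U [set n | (l <= n)%N] by apply: ooU; exists l.
have big_index (C : R) : U [set j | C <= M j].
  apply: filterS (oo_ge (Num.trunc C)) => j /= hj; apply: le_trans (hM j).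
  by apply: ltW; apply: lt_le_trans (truncnS_gt _) _; rewrite ler_nat ltnS.
have [b b1 hb] := letters_bound.
have b0 : 0 <= b by apply: le_trans b1.
pose c j := t j ^+ k j / M j.
have c0 j : 0 <= c j by rewrite divr_ge0 ?exprn_ge0// ltW.
(* Since [t j <= 1], a word shorter than [l] has scaled norm at most [b ^+ l], whereas the [j]-th
   word reaches [M j / 2] and [M j >= 3 * b ^+ l]. *)
have k_large l : U [set j | (l <= k j)%N].
  apply: filterS (big_index (3 * b ^+ l)) => j /= hj.
  rewrite leqNgt; apply/negP => kl.
  have [x x0 hx] := hlong j.
  have : t j ^+ k j * nrm (wd L (f j) 0 (k j) x) <= b ^+ l * nrm x.
    apply: le_trans (_ : 1 * (b ^+ k j * nrm x) <= _).
      apply: ler_pM; rewrite ?nrm_ge0 ?exprn_ge0//; first exact: ltW.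
      by rewrite exprn_ile1// ltW.
    by rewrite mul1r ler_wpM2r ?nrm_ge0// ler_weXn2l// ltnW.
  have bl : 0 < b ^+ l by rewrite exprn_gt0// (lt_le_trans ltr01).
  have := nrm_gt0 x0; nra.
(* A factor of length [l] needs only [t j ^+ l] of the scalar [t j ^+ k j]; the remaining power of
   [t j] is at most 1. *)
have wbd j a l : (0 <= a)%N -> (a + l <= 0 + k j)%N -> forall x,
    c j * nrm (wd L (f j) a l x) <= 1 * nrm x.
  move=> _; rewrite add0n => al x; rewrite mul1r /c mulrAC ler_pdivrMr// mulrC.
  have lk : (l <= k j)%N by apply: leq_trans al; exact: leq_addl.
  rewrite [X in _ <= X]mulrC -(subnK lk) exprD.
  apply: le_trans (hbd j (f j) a l x); rewrite mulrC -[X in _ <= X]mul1r -mulrA.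
  by apply: ler_wpM2r; [rewrite mulr_ge0 ?nrm_ge0// exprn_ge0// ltW|
    rewrite exprn_ile1// ltW].
have [W [bW limW _]] := ulim_wd bL dot_norm gB r01 nL UU c0 k_large wbd.
have /bounded_opP[linW [C C0 hC]] := bW.
have w1 j x : nrm ((c j)%:C *: wd L (f j) 0 (k j) x) <= nrm x.
  by rewrite nrmZR//; have := wbd j 0%N (k j) (leqnn _) (leqnn _) x; rewrite mul1r.
have WpW p l x : W (wd L p 0 l (W x)) = 0.
  have blp : 0 <= b ^+ l by rewrite exprn_ge0.
  apply: (@nrm_small_eq0 _ _ _ ((C * b ^+ l + b ^+ l + 1) * nrm x)) => e e0.
  have et : 0 < e * t0 ^+ l by rewrite mulr_gt0// exprn_gt0.
  have [j [/= h1 h2]] :=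
    filter_ex (filterI (limW _ e0) (big_index (e * t0 ^+ l)^-1)).
  set w := fun y => (c j)%:C *: wd L (f j) 0 (k j) y in h1.
  have lin_w : linear (wd L (f j) 0 (k j)) by exact: linear_wd.
  have lin_p : linear (wd L p 0 l) by exact: linear_wd.
  have -> : W (wd L p 0 l (W x)) = W (wd L p 0 l (W x - w x)) +
      ((W (wd L p 0 l (w x)) - w (wd L p 0 l (w x))) + w (wd L p 0 l (w x))).
    by rewrite subrK (linmapB lin_p) (linmapB linW) subrK.
  have x0 := nrm_ge0 x.
  have h3 : nrm (W (wd L p 0 l (W x - w x))) <= C * (b ^+ l * (e * nrm x)).
    apply: (le_trans (hC _)); apply: ler_wpM2l => //.
    apply: (le_trans (hb _ _ _ _)); apply: ler_wpM2l => //.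
    by rewrite nrmC; exact: h1.
  have h4 : nrm (W (wd L p 0 l (w x)) - w (wd L p 0 l (w x))) <= e * (b ^+ l * nrm x).
    rewrite nrmC; apply: (le_trans (h1 _)); apply: ler_wpM2l; first exact: ltW.
    by apply: (le_trans (hb _ _ _ _)); apply: ler_wpM2l => //; exact: w1.
  (* This is one word of length [2 k j + l], scaled by the square of [c j]. The bound [M j] on
     scaled words leaves at most [t j ^- l / M j], and [j] was chosen with [M j >= 1 / (e t0 ^+ l)];
     this is why the scalars must stay above [t0]. *)
  have h5 : nrm (w (wd L p 0 l (w x))) <= e * nrm x.
    rewrite /w (linmapZ lin_p) (linmapZ lin_w) scalerA -rmorphM/=.
    rewrite (nrmZR _ (mulr_ge0 (c0 j) (c0 j))).
    have [q1 hq1] := wd_cat L (f j) p (k j) l.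
    have [q2 hq2] := wd_cat L q1 (f j) (k j + l) (k j).
    rewrite -hq1 -hq2.
    have := hbd j q2 0%N (k j + l + k j)%N x.
    set n := nrm (wd L q2 _ _ _).
    have n0 : 0 <= n by exact: nrm_ge0.
    rewrite !exprD => hn.
    have tl : t0 ^+ l <= t j ^+ l.
      by apply: lerXn2r; rewrite ?nnegrE; [exact: ltW|exact: ltW|case/andP: (ht j)].
    have Me : 1 <= e * t j ^+ l * M j.
      apply: le_trans (_ : e * t0 ^+ l * M j <= _).
        by rewrite -ler_pdivrMl// mulr1.
      by rewrite ler_pM2r// ler_pM2l.
    rewrite /c; set T := t j ^+ k j in hn *; set S := t j ^+ l in hn Me.
    have T0 : 0 <= T by rewrite exprn_ge0// ltW.
    have S0 : 0 < S by rewrite exprn_gt0.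
    rewrite (_ : T / M j * (T / M j) * n = (T * T * n) / M j / M j); last first.
      by field; rewrite gt_eqF.
    rewrite !ler_pdivrMr//.
    have : T * T * n * S <= M j * nrm x.
      by apply: le_trans hn; rewrite le_eqVlt; apply/orP; left; apply/eqP; ring.
    move=> h6; apply: le_trans (_ : T * T * n * (e * S * M j) <= _).
      by rewrite -[X in X <= _]mulr1 ler_wpM2l// !mulr_ge0.
    rewrite (_ : T * T * n * (e * S * M j) = (T * T * n * S) * (e * M j)); last by ring.
    rewrite (_ : e * nrm x * M j * M j = (M j * nrm x) * (e * M j)); last by ring.
    by apply: ler_wpM2r => //; rewrite ltW// mulr_gt0.
  apply: (le_trans (nrmD _ _)).
  have := nrmD (W (wd L p 0 l (w x)) - w (wd L p 0 l (w x))) (w (wd L p 0 l (w x))).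
  nra.
have [x Wx0] : exists x, W x != 0.
  apply: contrapT => /forallNP hW.
  have W0 x : W x = 0 by apply/eqP; apply: contrapT => /negP; exact: hW.
  (* The normalized words have norm at least 1/2, so they cannot come within 1/4 of the zero
     operator. *)
  have e4 : 0 < 1 / 4 :> R by lra.
  have [j /= h1] := filter_ex (limW _ e4).
  have [x x0 hx] := hlong j; have := h1 x; rewrite W0 subr0 nrmZR// /c.
  rewrite mulrAC ler_pdivrMr// => h2; have := nrm_gt0 x0; have := M0 j.
  move=> m0 n0; have := mulr_gt0 m0 n0; lra.
have W0 z : W z = 0.
  apply: (@nrm_small_eq0 _ _ _ C) => e e0.
  have [a [p [l h]]] := dense_words z Wx0 e0.
  have -> : W z = W (z - a *: wd L p 0 l (W x)).
    by rewrite (linmapB linW) (linmapZ linW) WpW scaler0 subr0.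
  by apply: (le_trans (hC _)); rewrite mulrC ler_wpM2r// nrmC ltW.
by move/eqP: Wx0; apply.
Qed.

Variable X : set (H -> H).
Hypothesis algX : is_subalgebra X.
Hypothesis XL : forall i, X (L i).
Variable d : R.
Hypothesis d_gt0 : 0 < d.
Hypothesis long_words : forall k, exists f, exists2 x, x != 0 &
  d * nrm x <= nrm (wd L f 0 k x).

(** The supremum of the tame scalars is the inverse of the joint spectral radius of the letters; it
    may or may not be tame itself. *)
Let tame (t : R) : Prop :=
  exists C : R, forall f m k x, t ^+ k * nrm (wd L f m k x) <= C * nrm x.

Lemma tame_le1 (t : R) : tame t -> t <= 1.
Proof.
move=> [C hC]; rewrite leNgt; apply/negP => t1.
have t0 : 0 < t by apply: lt_trans t1.
have ti : 0 <= t^-1 < 1 by rewrite invr_ge0 ltW// invf_lt1.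
have [l hl] := expr_small ti (divr_gt0 d_gt0 (ltr_wpDl (normr_ge0 C) ltr01)).
have [f [x x0 hx]] := long_words l.
have nx := nrm_gt0 x0; have := hC f 0%N l x.
have tl : 0 < t ^+ l by rewrite exprn_gt0.
have : t ^+ l * (d * nrm x) <= t ^+ l * nrm (wd L f 0 l x) by rewrite ler_pM2l.
have : `|C| + 1 <= t ^+ l * d.
  move: hl; rewrite exprVn ler_pdivlMr ?ltr_wpDl//.
  by rewrite -ler_pdivlMl ?invr_gt0// invrK.
have := ler_norm C; nra.
Qed.

(** A word is cut into blocks of length [k], which do not increase norms, and a remainder of fewer
    than [k] letters, bounded by [B ^+ k]. *)
Lemma tame_short (t : R) k : 0 <= t -> (0 < k)%N ->
  (forall f m x, t ^+ k * nrm (wd L f m k x) <= nrm x) -> tame t.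
Proof.
move=> t0 k0 hk; have [b b1 hb] := letters_bound.
have b0 : 0 <= b by apply: le_trans b1.
pose B := Num.max 1 (t * b).
have B1 : 1 <= B by rewrite le_max lexx.
exists (B ^+ k) => f m n; elim/ltn_ind: n => n IH x.
have [kn|nk] := leqP k n; last first.
  apply: le_trans (_ : B ^+ n * nrm x <= _); last first.
    by rewrite ler_wpM2r ?nrm_ge0// ler_weXn2l// ltnW.
  apply: le_trans (_ : t ^+ n * (b ^+ n * nrm x) <= _).
    by rewrite ler_wpM2l// exprn_ge0.
  rewrite mulrA -exprMn ler_wpM2r ?nrm_ge0// lerXn2r// ?nnegrE ?mulr_ge0//.
    by apply: le_trans B1.
  by rewrite le_max lexx orbT.
rewrite -(subnK kn) wd_add exprD -mulrA.
apply: le_trans (IH (n - k)%N _ x); last by rewrite ltn_subrL k0 (leq_trans k0).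
by rewrite ler_wpM2l ?exprn_ge0.
Qed.

Lemma wd_scale (t : R) f m k x :
  wd (fun i x => t%:C *: L i x) f m k x = (t ^+ k)%:C *: wd L f m k x.
Proof.
elim: k => [|k IH]; first by rewrite scale1r.
by rewrite /= IH (linmapZ (proj1 (bL _))) scalerA -rmorphM/= exprS.
Qed.

Lemma exists_idempotent : exists P, [/\ nclosure X P, forall x, P (P x) = P x,
  (forall e : R, 0 < e -> near_fr dot P e) & P != (fun=> 0)].
Proof.
have [b b1 hb] := letters_bound.
have b0 : 0 < b by apply: lt_le_trans b1.
pose S := [set t : R | 0 <= t /\ tame t].
pose t0 := b^-1.
have t00 : 0 < t0 by rewrite invr_gt0.
have St0 : S t0.
  split; first exact: ltW.
  exists 1 => f m k x; rewrite mul1r exprVn ler_pdivrMl ?exprn_gt0//.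
have supS : has_sup S by split; [exists t0|exists 1 => t [_ /tame_le1]].
pose ts := sup S.
have ts_ge t : S t -> t <= ts by move=> St; apply: ub_le_sup => //; exact: supS.2.
have ts0 : 0 < ts by apply: lt_le_trans t00 _; exact: ts_ge.
have ts1 : ts <= 1 by apply: ge_sup; [exact: supS.1|move=> t [_ /tame_le1]].
have [[C hC]|wild] := pselect (tame ts).
  pose L' i x := ts%:C *: L i x.
  have bL' i : bounded_operators H (L' i) by exact: bounded_scale.
  have XL' i : X (L' i) by exact: alg_scale.
  have nL' i : near_fr dot (L' i) r.
    apply: near_fr_le (near_frZ ts%:C (nL i)).
    rewrite nrm_real (ger0_norm (ltW ts0)).
    by have /andP[r0 _] := r01; apply: ler_piMl.
  have half0 : 0 < 1 / 2 :> R by lra.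
  apply: (@idempotent_in_closure _ _ _ L' bL' X algX XL' dot dot_norm g gB r r01 nL'
    U UU ooU (`|C| + 1) _ _ (1 / 2) half0); first by rewrite ltr_wpDl.
    move=> f m k x; rewrite wd_scale (nrmZR _ (exprn_ge0 k (ltW ts0))).
    apply: (le_trans (hC f m k x)); rewrite ler_wpM2r ?nrm_ge0//.
    by rewrite (le_trans (ler_norm _))// lerDl.
  move=> k; apply: contrapT => /forallNP hshort.
  have short f x : x != 0 -> ts ^+ k * nrm (wd L f 0 k x) < 1 / 2 * nrm x.
    move=> x0; rewrite ltNge; apply/negP => h; apply: (hshort f); exists x => //.
    by rewrite wd_scale nrmZR// exprn_ge0// ltW.
  have k0 : (0 < k)%N.
    rewrite lt0n; apply/eqP => k0; have [f [x x0 _]] := long_words 0%N.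
    have := short f x x0; rewrite k0 expr0 mul1r /=; have := nrm_gt0 x0; lra.
  (* If all words of length [k] scaled by [ts] had norm below 1/2, the factor [(1 + e) ^+ k <= 2]
     would still leave norms at most 1, making the larger scalar [ts * (1 + e)] tame. *)
  have [e e0 he] := @expr_close1 R k 2 (ltr1n R 2).
  have : ts * (1 + e) <= ts.
    apply: ts_ge; split; first by rewrite mulr_ge0 ?ltW// ltr_wpDl.
    apply: (@tame_short _ k) => //; first by rewrite mulr_ge0 ?ltW// ltr_wpDl.
    move=> f m x; have [->|x0] := eqVneq x 0.
      by rewrite (linmap0 (linear_wd bL f m k)) nrm0 mulr0.
    rewrite (@wd_ext _ _ _ L f (fun i => f (m + i)%N) m 0 k)//.
    have := short (fun i => f (m + i)%N) x x0; rewrite exprMn.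
    set n := nrm (wd _ _ _ _ _); have n0 : 0 <= n by exact: nrm_ge0.
    have tk : 0 <= ts ^+ k by rewrite exprn_ge0// ltW.
    have := mulr_ge0 tk n0; have e1 : 0 <= (1 + e) ^+ k by rewrite exprn_ge0//; lra.
    move: (ts ^+ k) tk ((1 + e) ^+ k) e1 he => T T0 Q Q0 hQ h1 h2.
    rewrite -mulrA mulrCA; nra.
  by have := mulr_gt0 ts0 e0; lra.
exfalso.
have step j : exists tM : (R * R) * ((nat -> I) * nat), let: ((t, M), (f, k)) := tM in
  [/\ t0 <= t <= 1, j.+1%:R <= M,
      forall p m l x, t ^+ l * nrm (wd L p m l x) <= M * nrm x &
      exists2 x, x != 0 & M / 2 * nrm x <= t ^+ k * nrm (wd L f 0 k x)].
  have [f [m [k [x hx]]]] : exists f m k x,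
      2 * j.+1%:R * nrm x < ts ^+ k * nrm (wd L f m k x).
    apply: contrapT => h; apply: wild; exists (2 * j.+1%:R) => f m k x.
    rewrite leNgt; apply/negP => h'; apply: h; exists f, m, k, x; exact: h'.
  (* Passing from [ts] to a tame scalar above [ts / (1 + e)] at most halves the scaled norm of this
     word of length [k]. This is the reason for the factor 2 in front of [j.+1]. *)
  have [e e0 he] := @expr_close1 R k 2 (ltr1n R 2).
  have [t St ht] : exists2 t, S t & ts / (1 + e) < t.
    have e1 : 0 < ts - ts / (1 + e).
      rewrite subr_gt0 ltr_pdivrMr ?ltr_wpDl// ltr_pMr//; lra.
    have [t St h] := sup_adherent e1 supS; exists t => //.
    by move: h; rewrite -/ts opprB addrC subrK.
  have tt0 : 0 <= t by case: St.
  (* Still tame, and bounded below by [t0] uniformly in [j]. *)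
  pose t' := Num.max t t0.
  have St' : S t' by rewrite /t'; case: leP.
  have [t'0 [C hC]] := St'.
  have t't : t <= t' by rewrite le_max lexx.
  have tst : ts ^+ k <= 2 * t' ^+ k.
    apply: le_trans (_ : (1 + e) ^+ k * t' ^+ k <= _); last first.
      by rewrite ler_wpM2r// exprn_ge0.
    rewrite -exprMn; apply: lerXn2r; rewrite ?nnegrE; first exact: ltW.
      by apply: mulr_ge0 => //; lra.
    have e1 : 0 < 1 + e by lra.
    rewrite mulrC -ler_pdivrMr//; exact: ltW (lt_le_trans ht t't).
  (* Its supremum is the best uniform bound on words at scale [t']: finite by tameness, at least
     [j.+1] by the word just found, and attained up to a factor 2. *)
  pose D := [set y : R | exists p m l x, nrm x <= 1 /\ y = t' ^+ l * nrm (wd L p m l x)].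
  have x0 : x != 0.
    apply/eqP => x0; move: hx.
    by rewrite x0 (linmap0 (linear_wd bL f m k)) nrm0 !mulr0 ltxx.
  have nx := nrm_gt0 x0.
  have scaled p n l z : z != 0 -> D (t' ^+ l * nrm (wd L p n l z) / nrm z).
    move=> z0; have nz := nrm_gt0 z0; exists p, n, l, ((nrm z)^-1%:C *: z).
    rewrite (linmapZ (linear_wd bL _ _ _)) !(nrmZR _ (_ : 0 <= (nrm z)^-1)) ?invr_ge0 ?(ltW nz)//.
    by rewrite mulVf ?gt_eqF//; split => //; rewrite [_^-1 * _]mulrC mulrA.
  have supD : has_sup D.
    split; first by exists (t' ^+ k * nrm (wd L f m k x) / nrm x); exact: scaled.
    exists `|C| => _ [p [n [l [z [z1 ->]]]]]; apply: (le_trans (hC _ _ _ _)).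
    by have := ler_norm C; have := normr_ge0 C; have := nrm_ge0 z; nra.
  pose M := sup D.
  have M_ge y : D y -> y <= M by move=> Dy; apply: ub_le_sup => //; exact: supD.2.
  have Mj : j.+1%:R <= M.
    apply: le_trans (M_ge _ (scaled f m k x x0)).
    rewrite ler_pdivlMr//.
    have : ts ^+ k * nrm (wd L f m k x) <= 2 * t' ^+ k * nrm (wd L f m k x).
      by rewrite ler_wpM2r ?nrm_ge0.
    move: (j.+1%:R : R) hx => J; lra.
  have M0 : 0 < M by apply: lt_le_trans Mj; rewrite ltr0n.
  have [_ [p [n [l [z [z1 ->]]]]] hz] := sup_adherent (divr_gt0 M0 (ltr0Sn R 1)) supD.
  exists ((t', M), ((fun i => p (n + i)%N), l)); split => //.
  - apply/andP; split; first by rewrite le_max lexx orbT.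
    by apply: le_trans ts1; exact: ts_ge.
  - move=> q a i y; have [->|y0] := eqVneq y 0.
      by rewrite (linmap0 (linear_wd bL _ _ _)) nrm0 !mulr0.
    by rewrite -ler_pdivrMr ?nrm_gt0//; apply: M_ge; exact: scaled.
  - exists z.
      apply/eqP => z0; move: hz; rewrite z0 (linmap0 (linear_wd bL _ _ _)) nrm0 mulr0.
      rewrite -/M; lra.
    rewrite -(@wd_ext _ _ _ L p (fun i => p (n + i)%N) n 0 l)//.
    move: hz; rewrite -/M; have := nrm_ge0 z; nra.
have [F hF] := choice step.
apply: (@words_not_unbounded t0 (fun j => (F j).1.1) (fun j => (F j).1.2)
  (fun j => (F j).2.1) (fun j => (F j).2.2)) => // j.
- by have := hF j; case: (F j) => -[t M] [f k] [].
- by have := hF j; case: (F j) => -[t M] [f k] [].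
- by have := hF j; case: (F j) => -[t M] [f k] [].
- by have := hF j; case: (F j) => -[t M] [f k] [].
Qed.

End SpectralRadius.

(** * Essential norm of a weighted shift plus a nuclear operator *)

Section EssentialNorm.
Set Implicit Arguments.
Unset Strict Implicit.
Local Open Scope complex_scope.
Variables (R : realType) (H : completeNormedModType R[i]).
Variable dot : {dot H for Num.conj}.
Hypothesis dot_norm : inner_product_norm dot.
Implicit Types (x y z : H) (A B S K T : H -> H).

Lemma cvg_nrm (E : normedModType R[i]) (u : nat -> E) (l : E) (e : R) :
  u @ \oo --> l -> 0 < e -> exists N, forall n, (N <= n)%N -> nrm (u n - l) < e.
Proof.
move=> ul e0; have : nbhs l [set y | nrm (l - y) < e] by apply/nbhs_nrm; exists e.
move=> /ul [N _ hN]; exists N => n Nn; rewrite nrmC; exact: hN.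
Qed.

(** Truncating the series leaves an operator bounded by a tail of the sum of [|a n| * |b n|]. *)
Lemma near_fr_nuclear K (e : R) : nuclear dot K -> 0 < e -> near_fr dot K e.
Proof.
move=> [a [b [/cvg_ex[/= l hl] hK]]] e0.
have e2 : 0 < e / 3 by rewrite divr_gt0.
have [N hN] := @cvg_nrm R[i]^o _ _ _ hl e2.
exists (fun x => series (fun n => dot x (a n) *: b n) N).
  exists [seq (a n, b n) | n <- index_iota 0 N] => x.
  by rewrite big_map seriesEnat.
move=> x; apply: (@le_trans _ _ (2 * (e / 3) * nrm x)); last first.
  by apply: ler_wpM2r; [exact: nrm_ge0|lra].
apply: (@nrm_small_le _ _ _ _ 1).
  move=> d d0; rewrite mulr1.
  have [M hM] := cvg_nrm (hK x) d0.
  have hMx := hM (maxn M N) (leq_maxl _ _).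
  apply: (le_trans (nrm_dist (series (fun n => dot x (a n) *: b n) (maxn M N)) _ _)).
  apply: lerD; first by rewrite nrmC ltW.
  rewrite sub_series_geq ?leq_maxr//.
  apply: (le_trans (nrm_sum _ _ _)).
  apply: le_trans (_ : (\sum_(N <= n < maxn M N) nrm (a n) * nrm (b n)) * nrm x <= _).
    rewrite mulr_suml; apply: ler_sum => n _; rewrite nrmZ.
    have := nrm_dot dot_norm x (a n); have := nrm_ge0 (b n); nra.
  apply: ler_wpM2r; first exact: nrm_ge0.
  have h1 := hN N (leqnn N); have h2 := hN (maxn M N) (leq_maxr _ _).
  have := nrm_dist l (series (fun n => `|a n| * `|b n|) (maxn M N) : R[i]^o)
    (series (fun n => `|a n| * `|b n|) N).
  rewrite (nrmC l) sub_series_geq ?leq_maxr//.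
  have -> : \sum_(N <= k < maxn M N) `|a k| * `|b k| =
      (\sum_(N <= n < maxn M N) nrm (a n) * nrm (b n))%:C.
    by rewrite rmorph_sum/=; apply: eq_bigr => k _; rewrite !normE -rmorphM.
  rewrite nrm_real ger0_norm; last by apply: sumr_ge0 => k _; rewrite mulr_ge0 ?nrm_ge0.
  move=> h3; apply: (le_trans h3); move: h1 h2; lra.
Qed.

Variable g : nat -> H.
Hypothesis gB : orthonormal_basis dot g.

(** Subtract the action of [S] on the first [N] coordinates. On the others the weights are at most
    [1 + d], and [S] maps distinct basis vectors to orthogonal ones, so the norm is at most
    [1 + d]. *)
Lemma near_fr_shift (w : nat -> R) S (d : R) : forward_weighted_shift g w S ->
  (forall j, 0 <= w j <= 2) ->
  (forall e : R, 0 < e -> \forall j \near \oo, w j = 0 \/ `|w j - 1| < e) ->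
  0 < d -> near_fr dot S (1 + d).
Proof.
move=> [bS hS] w02 hw d0.
have [N _ hN] := hw d d0.
have wN j : (N <= j)%N -> 0 <= w j <= 1 + d.
  move=> Nj; have /andP[w0 _] := w02 j; rewrite w0/=.
  have [->|] := hN j Nj; first lra.
  by rewrite ltr_norml => /andP[_ h]; lra.
have /bounded_opP[linS [C C0 hC]] := bS.
exists (S \o (fun x => oproj dot g x N)).
  by apply: frank_compl => //; exact: frank_oproj.
move=> x; rewrite /= -(linmapB linS); set z := x - oproj dot g x N.
have zj j : (j < N)%N -> dot z (g j) = 0.
  by move=> jN; rewrite /z dotBl (dot_psum gB) jN subrr.
have zx : nrm z <= nrm x by exact: (nrm_oproj_compl dot_norm gB).
clearbody z.
(* Coordinates of [S z]: those of [z] move up by one, with a 0 in front. So [M] coordinates of [z]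
   correspond to [M.+1] coordinates of [S z]. *)
pose e j := if j is j'.+1 then dot z (g j') * (w j')%:C else 0.
have SE M : S (oproj dot g z M) = psum g e M.+1.
  elim: M => [|M IH].
    by rewrite psumS /oproj /psum !big_ord0 (linmap0 linS) scale0r addr0.
  rewrite psumS -IH /oproj psumS (linmapD linS) (linmapZ linS) hS scalerA.
  by [].
have nSE M : nrm (psum g e M.+1) <= (1 + d) * nrm (oproj dot g z M).
  apply: nrm_le_sqr; first by rewrite mulr_ge0 ?nrm_ge0//; lra.
  rewrite exprMn; elim: M => [|M IH].
    rewrite (nrm_psumS dot_norm gB) /psum big_ord0 nrm0 expr0n /= nrm0.
    by rewrite add0r expr0n/= mulr_ge0// sqr_ge0.
  rewrite (nrm_psumS dot_norm gB e M.+1).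
  rewrite /oproj (nrm_psumS dot_norm gB (fun j => dot z (g j)) M) mulrDr.
  apply: lerD => //; rewrite /= nrmM nrm_real exprMn mulrC.
  have [MN|NM] := ltnP M N; first by rewrite zj// nrm0 expr0n /= !mulr0.
  apply: ler_wpM2r; first exact: sqr_ge0.
  by have /andP[w0 w1] := wN M NM; rewrite ger0_norm// lerXn2r// nnegrE; lra.
apply: (@nrm_small_le _ _ _ ((1 + d) * nrm x) C) => e' e'0.
have [M hM] := oproj_cvg dot_norm gB z e'0.
have -> : S z = S (z - oproj dot g z M) + psum g e M.+1.
  by rewrite (linmapB linS) -SE subrK.
apply: (le_trans (nrmD _ _)); apply: lerD.
  by apply: (le_trans (hC _)); rewrite mulrC ler_wpM2r//; exact: hM.
apply: (le_trans (nSE M)); apply: ler_wpM2l; first lra.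
exact: le_trans (nrm_oproj dot_norm gB z M) zx.
Qed.

Lemma bounded_iter T n : bounded_operators H T -> bounded_operators H (iter n T).
Proof.
move=> bT; elim: n => [|n IH]; first exact: bounded_id.
exact: bounded_comp bT IH.
Qed.

(** The excess [d] is chosen after [n], with [(1 + d) ^+ n <= 2]; hence a bound that does not depend
    on [n]. *)
Lemma near_fr_iter T n : bounded_operators H T ->
  (forall d : R, 0 < d -> near_fr dot T (1 + d)) -> near_fr dot (iter n T) 2.
Proof.
move=> bT hT; have [d d0 hd] := @expr_close1 R n 2 (ltr1n R 2).
apply: near_fr_le hd _; elim: n => [|n IH].
  by exists (fun=> 0); [exact: frank0|move=> x; rewrite subr0 expr0 mul1r].
rewrite exprS; apply: (near_fr_comp dot_norm gB (proj1 bT) (bounded_iter n bT) _ (hT d d0) IH).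
lra.
Qed.

End EssentialNorm.

Section ReadPower.
Set Implicit Arguments.
Unset Strict Implicit.
Variables (R : realType) (H : completeNormedModType R[i]).
Variable dot : {dot H for Num.conj}.
Hypothesis dot_norm : inner_product_norm dot.

Lemma read_near_fr_iter T : read_type_operator dot T -> exists2 g,
  orthonormal_basis dot g & forall n, near_fr dot (iter n T) 2.
Proof.
move=> [bT _ _ _ [g [w [S [K [gB hS [w02 hw] [nK _] TE]]]]]].
exists g => // n; apply: (near_fr_iter dot_norm gB) => // d d0.
have d2 : 0 < d / 2 by rewrite divr_gt0.
have -> : T = (fun x => S x + K x) by rewrite TE.
apply: (@near_fr_le _ _ _ _ (1 + d / 2 + d / 2)); first lra.
apply: near_frD; last exact: near_fr_nuclear.
exact: (near_fr_shift dot_norm gB hS).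
Qed.

End ReadPower.

(** * Weak compactness and the finite choice of letters *)

Section Covering.
Set Implicit Arguments.
Unset Strict Implicit.
Local Open Scope complex_scope.
Variables (R : realType) (H : completeNormedModType R[i]).
Variable dot : {dot H for Num.conj}.
Hypothesis dot_norm : inner_product_norm dot.
Variable g : nat -> H.
Hypothesis gB : orthonormal_basis dot g.
Variables (U : set_system nat) (UU : UltraFilter U).
Hypothesis ooU : \oo `<=` U.
Implicit Types (x y z : H).

(** Finite rank operators turn weak convergence into norm convergence. *)
Lemma frank_weak F (u : nat -> H) y (e : R) : frank dot F ->
  (forall z (e : R), 0 < e -> U [set n | nrm (dot (u n - y) z) <= e]) ->
  0 < e -> U [set n | nrm (F (u n - y)) <= e].
Proof.
move=> [s hs] hu; elim: s F hs e => [|p s IH] F hs e e0.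
  by apply: filterS filterT => n _ /=; rewrite hs big_nil nrm0 ltW.
have e2 : 0 < e / 2 by rewrite divr_gt0.
have p1 : 0 < nrm p.2 + 1 by rewrite ltr_wpDl// nrm_ge0.
have h := IH (fun x => \sum_(q <- s) dot x q.1 *: q.2) (fun=> erefl) _ e2.
apply: filterS2 h (hu p.1 _ (divr_gt0 e2 p1)) => n /= h1 h2.
rewrite hs big_cons; apply: (le_trans (nrmD _ _)); rewrite nrmZ.
have : nrm (dot (u n - y) p.1) * (nrm p.2 + 1) <= e / 2 by rewrite -ler_pdivlMr.
have := nrm_ge0 (dot (u n - y) p.1); nra.
Qed.

(* Weak compactness of the ball: an operator within 1/4 of a finite rank operator
   that sends [y] close to [x0] also sends a weak neighbourhood of [y] in the
   ball close to [x0]. *)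
Lemma finite_covering (B : finType) (A : B -> nat -> H -> H) (x0 : H) :
  (forall b n, linear (A b n)) -> (forall b n, near_fr dot (A b n) (1 / 4)) ->
  (forall y z (e : R), y != 0 -> 0 < e -> exists b n, nrm (A b n y - z) < e) ->
  1 < nrm x0 ->
  exists N : nat, forall y, nrm (y - x0) <= 1 ->
    exists b, exists2 n, (n < N)%N & nrm (A b n y - x0) <= 1.
Proof.
move=> linA nA hA nx0; apply: contrapT => /forallNP hN.
have /choice[u hu] N : exists y, nrm (y - x0) <= 1 /\
    forall b n, (n < N)%N -> 1 < nrm (A b n y - x0).
  have /existsNP[y /not_implyP[y1 h]] := hN N.
  exists y; split => // b n nN; rewrite ltNge; apply/negP => h'.
  by apply: h; exists b, n.
have ub n : nrm (u n) <= 1 + nrm x0.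
  by have := nrmBB (u n) x0; have := (hu n).1; lra.
have [y hy] := weak_ulim UU dot_norm gB ub.
have y1 : nrm (y - x0) <= 1.
  (* The ball is weakly closed: the square of [|y - x0|] is the limit of [dot (u n - x0) (y - x0)],
     hence at most [|y - x0|]. *)
  have : nrm (dot (y - x0) (y - x0)) <= nrm (y - x0).
    apply: (@nrm_small_le _ _ _ _ 1) => e e0.
    have [n /= hn] := filter_ex (hy (y - x0) e e0).
    have -> : dot (y - x0) (y - x0) =
        dot (u n - x0) (y - x0) - dot (u n - y) (y - x0).
      by rewrite -dotBl; congr (dot _ _); rewrite opprB [RHS]addrC addrA subrK.
    apply: (le_trans (nrmB _ _)); rewrite mulr1 addrC; apply: lerD => //.
    apply: (le_trans (nrm_dot dot_norm _ _)); apply: ler_piMl; first exact: nrm_ge0.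
    exact: (hu n).1.
  rewrite dotxx// nrm_real ger0_norm ?sqr_ge0//.
  by have := nrm_ge0 (y - x0); nra.
have y0 : y != 0.
  apply/eqP => y0; have := y1; rewrite y0 sub0r nrmN; lra.
(* The radius 1 splits as 1/4 for [A b n y], 1/2 for [A b n - F] on a vector of norm at most 2, and
   1/4 for [F (u N - y)]. *)
have e4 : 0 < 1 / 4 :> R by lra.
have [b [n hn]] := hA y x0 _ y0 e4.
have [F fF hF] := nA b n.
have Un : U [set m | (n < m)%N] by apply: ooU; exists n.+1.
have [N [/= h1 h2]] := filter_ex (filterI (frank_weak fF hy e4) Un).
have := (hu N).2 b n h2; apply/negP; rewrite -leNgt.
have -> : A b n (u N) - x0 = (A b n y - x0) +
    ((A b n (u N - y) - F (u N - y)) + F (u N - y)).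
  by rewrite subrK (linmapB (linA b n)) [RHS]addrC addrA subrK.
have h3 := hF (u N - y).
have h4 : nrm (u N - y) <= 2.
  apply: (le_trans (nrm_dist x0 _ _)); rewrite (nrmC x0); have := (hu N).1; lra.
apply: (le_trans (nrmD _ _)).
have := nrmD (A b n (u N - y) - F (u N - y)) (F (u N - y)); lra.
Qed.

Lemma long_trajectory (I : finType) (L : I -> H -> H) (x0 : H) :
  (forall y, nrm (y - x0) <= 1 -> exists i, nrm (L i y - x0) <= 1) ->
  forall k, exists f, nrm (wd L f 0 k x0 - x0) <= 1.
Proof.
move=> hL; elim=> [|k [f hf]].
  have [|i _] := hL x0; first by rewrite subrr nrm0.
  by exists (fun=> i); rewrite /= subrr nrm0.
have [i hi] := hL _ hf; exists (fun j => if (j < k)%N then f j else i).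
rewrite /= add0n ltnn (@wd_ext _ _ _ L _ f 0 0 k)// => j jk.
by rewrite add0n jk.
Qed.

End Covering.

(** * Uniform, strong and weak closures *)

Section Main.
Set Implicit Arguments.
Unset Strict Implicit.
Local Open Scope complex_scope.
Variables (R : realType) (H : completeNormedModType R[i]).
Variable dot : {dot H for Num.conj}.
Hypothesis dot_norm : inner_product_norm dot.
Implicit Types (x y z : H) (A B S K T : H -> H) (X : set (H -> H)).

Lemma nclosure_uniform X : nclosure X `<=` uniform_closure X.
Proof.
move=> A [bA hA]; split => // e e0; have e2 : 0 < e / 2 by rewrite divr_gt0.
have [B XB hB] := hA _ e2; exists B => //.
apply: (@le_lt_trans _ _ (e / 2)); last by rewrite ltr_pdivrMr// ltr_pMr// ltr1n.
apply: ge_sup; first by exists (complex.Re `|(A - B) 0|), 0 => //=; rewrite normr0.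
move=> _ [x /= x1 <-]; rewrite -/(nrm ((A - B) x)).
have nx : nrm x <= 1 by rewrite -lecR -normE.
apply: (le_trans (hB x)); rewrite -[X in _ <= X]mulr1 ler_wpM2l// ltW//.
Qed.

(** The traces on [X] of the basic strong neighbourhoods of [A] generate a proper filter. It
    converges to [A] pointwise, and therefore its matrix coefficients converge too, which serves
    both topologies. *)
Lemma strong_closure_full X : X `<=` bounded_operators H ->
  (forall A (s : seq H) (e : R), bounded_operators H A -> 0 < e ->
     exists2 B, X B & forall x, x \in s -> nrm (A x - B x) < e) ->
  strong_closure X = bounded_operators H /\ weak_closure dot X = bounded_operators H.
Proof.
move=> bX hX.
have key A : bounded_operators H A -> exists2 G : set_system (H -> H), ProperFilter G &
    globally X `<=` G /\ forall x (e : R), 0 < e -> G [set B | nrm (A x - B x) < e].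
  move=> bA.
  pose G : set_system (H -> H) := [set P | exists (s : seq H) (e : R), 0 < e /\
    forall B, X B -> (forall x, x \in s -> nrm (A x - B x) < e) -> P B].
  exists G.
    split.
      move=> [s [e [e0 h]]]; have [B XB hB] := hX A s e bA e0; exact: h hB.
    split.
    - by exists [::], 1.
    - move=> P Q [s [e [e0 hP]]] [t [d [d0 hQ]]].
      exists (s ++ t), (Num.min e d); split; first by rewrite lt_min e0.
      move=> B XB hB; split.
        by apply: hP => // x xs; have := hB x; rewrite mem_cat xs lt_min => /(_ isT)/andP[].
      by apply: hQ => // x xs; have := hB x; rewrite mem_cat xs orbT lt_min => /(_ isT)/andP[].
    - move=> P Q PQ [s [e [e0 hP]]]; exists s, e; split => // B XB hB.
      by apply: PQ; exact: hP.
  split; first by move=> P hP; exists [::], 1; split => // B XB _; exact: hP.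
  move=> x e e0; exists [:: x], e; split => // B XB; apply.
  by rewrite inE.
split; apply/seteqP; split => [A []//|A bA]; split => //; have [G PG [GX GA]] := key A bA.
  rewrite closureEcvg; exists G => //; split => //.
  apply/pointwise_cvgP => x P /nbhs_nrm[e e0 hP].
  have : G [set B | P (B x)] by apply: filterS (GA x e e0) => B; exact: hP.
  by [].
move=> P /= [Q [[V oV <-] VA QP]].
have GV : G ((@matrix_coefficients R H dot) @^-1` V).
  have /(_ V) : {ptws, (@matrix_coefficients R H dot) @ G --> (matrix_coefficients dot A)}.
    apply/pointwise_cvgP => p Q' /(@nbhs_nrm R R[i]^o)[e e0 hQ].
    have p1 : 0 < nrm p.2 + 1 by rewrite ltr_wpDl// nrm_ge0.
    suff : G [set B | Q' (dot (B p.1) p.2)] by [].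
    apply: filterS (GA p.1 _ (divr_gt0 e0 p1)) => B /= hB; apply: hQ.
    rewrite /matrix_coefficients -dotBl; apply: (le_lt_trans (nrm_dot dot_norm _ _)).
    have : nrm (A p.1 - B p.1) * (nrm p.2 + 1) < e by rewrite -ltr_pdivlMr.
    by have := nrm_ge0 (A p.1 - B p.1); nra.
  by apply; apply: open_nbhs_nbhs; split.
have GX' : G X by apply: GX => B.
have [B [XB VB]] := filter_ex (filterI GX' GV).
by exists B; split => //; exact: QP.
Qed.

End Main.

(** * The generated algebra and tails of dense orbits *)

Section GeneratedAlgebra.
Set Implicit Arguments.
Unset Strict Implicit.
Variables (R : realType) (H : completeNormedModType R[i]).
Implicit Types (x y z : H) (A B : H -> H) (X : set (H -> H)).

Lemma bounded_subalgebra : is_subalgebra (@bounded_operators R H).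
Proof.
split => //; last by move=> A B; exact: bounded_comp.
split.
  apply/bounded_opP; split; first by move=> a x y; rewrite scaler0 addr0.
  by exists 0 => // x; rewrite mul0r nrm0.
by move=> a A B bA bB; exact: bounded_add (bounded_scale a bA) bB.
Qed.

Lemma generated_subalgebra X : X `<=` bounded_operators H ->
  is_subalgebra (generated_algebra X).
Proof.
move=> bX; split.
- by move=> A; apply; split => //; exact: bounded_subalgebra.
- split; first by move=> Y [[_ [Y0 _] _] _].
  by move=> a A B hA hB Y hY; have [[_ [_ h] _] _] := hY; apply: h; [exact: hA|exact: hB].
- by move=> A B hA hB Y hY; have [[_ _ h] _] := hY; apply: h; [exact: hA|exact: hB].
Qed.

Lemma generated_sub X : X `<=` generated_algebra X.
Proof. by move=> A XA Y [_]; apply. Qed.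

Lemma alg_iter X A n : is_subalgebra X -> X A -> X (iter n.+1 A).
Proof.
move=> [_ _ hX] XA; elim: n => [|n IH]; first exact: XA.
exact: hX XA IH.
Qed.

(* Removing the first point of a dense orbit leaves a dense set, as the space
   has no isolated point. *)
Lemma orbit_tail_dense (g : H) A y z (e : R) : nrm g = 1 -> dense (Orb A y) -> 0 < e ->
  exists n, nrm (iter n.+1 A y - z) < e.
Proof.
move=> g1 dO e0; have e2 : 0 < e / 2 by rewrite divr_gt0.
have [z1 z1y z1z] : exists2 z1, z1 != y & nrm (z1 - z) <= e / 2.
  have [->|zy] := eqVneq z y; last by exists z => //; rewrite subrr nrm0 ltW.
  exists ((e / 2)%:C%C *: g + y); last by rewrite addrK (nrmZR _ (ltW e2)) g1 mulr1.
  rewrite -subr_eq0 addrK; apply/eqP => h.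
  by have := congr1 (@nrm _ _) h; rewrite (nrmZR _ (ltW e2)) g1 mulr1 nrm0; lra.
(* Asking for a point closer to [z1] than [y] is rules out the index 0 of the orbit. *)
have d0 : 0 < Num.min (e / 2) (nrm (z1 - y)).
  by rewrite lt_min e2 nrm_gt0// subr_eq0.
have [_ [[|n] _ <-]] := dense_nrm z1 dO d0; rewrite lt_min => /andP[h1 h2].
  by rewrite /= ltxx in h2.
exists n; apply: (le_lt_trans (nrm_dist z1 _ _)); rewrite nrmC; lra.
Qed.

End GeneratedAlgebra.

(** * A finite rank operator from two families of powers *)

Section ReadAlgebra.
Set Implicit Arguments.
Unset Strict Implicit.
Local Open Scope complex_scope.
Variables (R : realType) (H : completeNormedModType R[i]).
Variable dot : {dot H for Num.conj}.
Hypothesis dot_norm : inner_product_norm dot.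
Variable g : nat -> H.
Hypothesis gB : orthonormal_basis dot g.
Implicit Types (x y z : H) (A B : H -> H).

Lemma finite_rank_from_orbits (T : bool -> H -> H) (X : set (H -> H)) :
  is_subalgebra X -> (forall b, X (T b)) ->
  (forall b n, near_fr dot (iter n (T b)) 2) ->
  (forall y, y != 0 -> exists b, forall z (e : R), 0 < e ->
     exists n, nrm (iter n.+1 (T b) y - z) < e) ->
  exists2 F, nclosure X F & frank dot F /\ F != (fun=> 0).
Proof.
move=> algX XT nT orbT.
(* Division by 8 turns the distance 2 into 1/4. Exponents start at 1 because the algebra need not
   contain the identity. *)
pose A b n x := (8^-1)%:C *: iter n.+1 (T b) x.
have i8 : 0 < 8^-1 :> R by rewrite invr_gt0.
have XA b n : X (A b n) by apply: alg_scale => //; exact: alg_iter.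
have bA b n : bounded_operators H (A b n) by exact: alg_bounded (XA b n).
have nA b n : near_fr dot (A b n) (1 / 4).
  apply: near_fr_le (near_frZ (8^-1)%:C (nT b n.+1)).
  by rewrite nrm_real (ger0_norm (ltW i8)); lra.
have near8 (u z : H) (e : R) : nrm (u - 8%:C *: z) < 8 * e -> nrm ((8^-1)%:C *: u - z) < e.
  move=> h; have -> : (8^-1)%:C *: u - z = (8^-1)%:C *: (u - 8%:C *: z).
    by rewrite scalerBr scalerA -rmorphM/= mulVf ?pnatr_eq0// scale1r.
  by rewrite (nrmZR _ (ltW i8)); lra.
have hA y z (e : R) : y != 0 -> 0 < e -> exists b n, nrm (A b n y - z) < e.
  move=> y0 e0; have [b hb] := orbT y y0.
  have e8 : 0 < 8 * e by lra.
  by have [n hn] := hb (8%:C *: z) _ e8; exists b, n; exact: near8.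
have [U [UU ooU]] := @ultraFilterLemma nat \oo _.
(* The unit ball around a vector of norm 2 avoids 0, and all its points have norm at least 1, half
   of [|x0|]: hence the lower bound 1/2 on long words. *)
pose x0 := 2%:C *: g 0.
have nx0 : nrm x0 = 2 by rewrite nrmZR// (nrm_basis dot_norm gB) mulr1.
have [N hN] : exists N : nat, forall y, nrm (y - x0) <= 1 ->
    exists b, exists2 n, (n < N)%N & nrm (A b n y - x0) <= 1.
  apply: (@finite_covering _ _ _ dot_norm _ gB U UU ooU _ A) => //.
    by move=> b n; exact: (proj1 (bA b n)).
  by rewrite nx0; lra.
(* One exponent more than the covering needs, so that [ord0] exists and both [T b] divided by 8 are
   letters. *)
pose L (i : (bool * 'I_N.+1)%type) := A i.1 i.2.
have long k : exists f, exists2 x, x != 0 & 1 / 2 * nrm x <= nrm (wd L f 0 k x).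
  have [|f hf] := @long_trajectory _ _ _ L x0 _ k.
    move=> y /hN[b [n nN hn]]; exists (b, Ordinal (ltnW nN : (n < N.+1)%N)).
    exact: hn.
  exists f, x0; first by apply/eqP => h; have := nx0; rewrite h nrm0; lra.
  rewrite nx0; have := nrmBB x0 (wd L f 0 k x0); rewrite nrmC nx0; lra.
have dense_words y z (e : R) : y != 0 -> 0 < e ->
    exists (a : R[i]) f k, nrm (a *: wd L f 0 k y - z) < e.
  move=> y0 e0; have [b hb] := orbT y y0; have [n hn] := hb z e e0.
  (* Undoes the division by 8 in each of the [n.+1] letters. *)
  exists (8 ^+ n.+1)%:C, (fun=> (b, ord0)), n.+1.
  have -> : wd L (fun=> (b, ord0)) 0 n.+1 y = (8^-1 ^+ n.+1)%:C *: iter n.+1 (T b) y.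
    have linT : linear (T b) by exact: (proj1 (alg_bounded algX (XT b))).
    elim: n.+1 => [|k IH]; first by rewrite scale1r.
    by rewrite /= IH {1}/L/= /A /= (linmapZ linT) scalerA -rmorphM/= -exprS.
  by rewrite scalerA -rmorphM/= -exprMn divff ?pnatr_eq0// expr1n scale1r.
have r01 : 0 <= (1 / 4 : R) < 1 by apply/andP; split; lra.
have half0 : 0 < 1 / 2 :> R by lra.
have bL i : bounded_operators H (L i) by exact: bA.
have nL i : near_fr dot (L i) (1 / 4) by exact: nA.
have XL i : X (L i) by exact: XA.
have [P [XP PP nP P0]] := exists_idempotent bL dot_norm gB r01 nL UU ooU
  dense_words algX XL half0 long.
exists P => //; split => //.
by apply: (idempotent_frank dot_norm gB (nclosure_bounded XP) PP); exact: nP.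
Qed.

End ReadAlgebra.

Theorem proposition3p2 (R : realType) (H : completeNormedModType R[i])
    (dot : {dot H for Num.conj}) (T V Vinv : H -> H)
    (dot_norm : inner_product_norm dot)
    (H_separable : separable_space H)
    (H_infinite : infinite_dimensional H)
    (T_read : read_type_operator dot T)
    (V_unitary : unitary dot V)
    (VK : cancel V Vinv) (VinvK : cancel Vinv V)
    (V_orbit : forall x : H, x != 0 ->
       dense (Orb T x) \/ dense (Orb T (V x))) :
  let T' := Vinv \o T \o V in
  let alg := generated_algebra [set T; T'] in
  [/\ unitarily_equivalent dot T T',
      weak_closure dot alg = bounded_operators H,
      strong_closure alg = bounded_operators H &
      compact_operators H `<=` uniform_closure alg].
Proof.
move=> T' alg; have [linV isoV _] := V_unitary.
have bT := read_bounded T_read.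
have linVi : linear Vinv.
  by move=> a x y; apply: (can_inj VK); rewrite VinvK linV !VinvK.
have isoVi x y : dot (Vinv x) (Vinv y) = dot x y.
  by have := isoV (Vinv x) (Vinv y); rewrite !VinvK.
have nrm_of_dot A : (forall x, dot (A x) (A x) = dot x x) -> forall x, nrm (A x) = nrm x.
  move=> hA x; apply/eqP; rewrite -(eqrXn2 (n := 2)) ?nrm_ge0//; apply/eqP.
  by apply: complexI; rewrite -!(dotxx dot_norm) hA.
have nV x : nrm (V x) = nrm x by apply: nrm_of_dot => {}x; exact: isoV.
have nVi x : nrm (Vinv x) = nrm x by apply: nrm_of_dot => {}x; exact: isoVi.
have bV : bounded_operators H V.
  by apply/bounded_opP; split => //; exists 1 => // x; rewrite nV mul1r.
have bVi : bounded_operators H Vinv.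
  by apply/bounded_opP; split => //; exists 1 => // x; rewrite nVi mul1r.
have bT' : bounded_operators H T' by exact: bounded_comp (bounded_comp bVi bT) bV.
have iterT' n x : iter n T' x = Vinv (iter n T (V x)).
  by elim: n => [|n IH] /=; rewrite ?VK// IH /T' /= VinvK.
have [g gB nT] := read_near_fr_iter dot_norm T_read.
have algX : is_subalgebra alg by apply: generated_subalgebra => A [->|->].
have XT : alg T by apply: generated_sub; left.
have XT' : alg T' by apply: generated_sub; right.
pose Tb (b : bool) := if b then T else T'.
have XTb b : alg (Tb b) by case: b.
have nTb b n : near_fr dot (iter n (Tb b)) 2.
  case: b; first exact: nT.
  have [F fF hF] := nT n; exists (Vinv \o F \o V).
    by apply: (frank_compr dot_norm gB bV); exact: frank_compl.
  by move=> x; rewrite /Tb iterT' /= -(linmapB linVi) nVi -(nV x); exact: hF.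
(* By conjugation, a dense orbit of [V y] under [T] is a dense orbit of [y] under [T']. *)
have orbT y : y != 0 -> exists b, forall z (e : R), 0 < e ->
    exists n, nrm (iter n.+1 (Tb b) y - z) < e.
  have g1 := nrm_basis dot_norm gB 0.
  move=> /V_orbit[dO|dO]; first by exists true => z e; exact: (orbit_tail_dense z g1 dO).
  exists false => z e e0; have [n hn] := orbit_tail_dense (V z) g1 dO e0.
  by exists n; rewrite /Tb iterT' -{1}(VK z) -(linmapB linVi) nVi.
have trX : transitive_family alg.
  move=> y z e y0 e0; have [b hb] := orbT y y0; have [n hn] := hb z e e0.
  by exists (iter n.+1 (Tb b)) => //; exact: (alg_iter n algX (XTb b)).
have exF : exists2 F, nclosure alg F & frank dot F /\ F != (fun=> 0).
  by apply: (finite_rank_from_orbits dot_norm gB algX XTb nTb orbT).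
have [strong weak] : strong_closure alg = bounded_operators H /\
    weak_closure dot alg = bounded_operators H.
  apply: (strong_closure_full dot_norm) => [A|A s e]; first exact: alg_bounded.
  exact: (strong_approx algX dot_norm gB trX exF).
split => //.
  (* The intertwining relation is [Vinv \o T = T' \o Vinv], so the unitary is the inverse of [V]. *)
  exists Vinv; last by apply/funext => x; rewrite /= /T' /= VinvK.
  split; [exact: linVi|exact: isoVi|move=> x _].
  by exists (V x) => //; rewrite VK.
move=> A cA; apply: nclosure_uniform.
exact: (compact_mem algX dot_norm gB trX exF).
Qed.
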